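(* Let $d\ge 1$ and $\lambda>0$. For every integer $n\ge 0$, every $P\in \mathcal{V}_n^d(W_{-1})$ satisfies $$L_{-1}P=\lambda_n^{(-1)}P,\qquad \lambda_n^{(-1)}=-n(n+d-2).$$ In particular, $L_{-1}$ has a complete polynomial basis of eigenfunctions, i.e. the space of all real polynomials in $d$ variables has a basis consisting of eigenfunctions of $L_{-1}$.
   Context: Let $B^d=\{x\in\mathbb{R}^d:\|x\|\le 1\}$ and $S^{d-1}=\{x\in\mathbb{R}^d:\|x\|=1\}$ (Euclidean norm), let $d\omega$ be the surface (Lebesgue) measure on $S^{d-1}$ and $\omega_d=\int_{S^{d-1}}d\omega=2\pi^{d/2}/\Gamma(d/2)$ (for $d=1$, $d\omega$ is counting measure on $\{-1,1\}$). For $\mu\in\mathbb{R}$ define the differential operator $$L_\mu=\Delta-\langle x,\nabla\rangle^2-(2\mu+d)\langle x,\nabla\rangle,$$ where $\Delta$ is the Laplacian on $\mathbb{R}^d$, $\langle x,\nabla\rangle=\sum_{i=1}^d x_i\frac{\partial}{\partial x_i}$, and $\langle x,\nabla\rangle^2$ is this operator applied twice. Put $\lambda_n^{(\mu)}=-n(n+2\mu+d)$. For a fixed $\lambda>0$ define on real polynomials in $d$ variables the inner product $$\langle f,g\rangle_{-1}=\frac{\lambda}{\omega_d}\int_{B^d}\nabla f(x)\cdot\nabla g(x)\,dx+\frac{1}{\omega_d}\int_{S^{d-1}}f(x)g(x)\,d\omega(x).$$ $\mathcal{V}_n^d(W_{-1})$ denotes the space of orthogonal polynomials of degree $n$ with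 respect to $\langle\cdot,\cdot\rangle_{-1}$, i.e. the real vector space of polynomials $P$ of total degree at most $n$ such that $\langle P,g\rangle_{-1}=0$ for every polynomial $g$ of total degree less than $n$. *)

(* Defs.v *)
From HB Require Import structures.
From mathcomp Require Import all_boot all_order all_algebra.
(* mpoly comes before mathcomp-analysis and without its notations: some of them
   clash, and both libraries declare a mixin called isMeasure. *)
From mathcomp Require Import -(notations) mpoly.
From mathcomp Require Import all_classical all_reals all_analysis.
From mathcomp Require Import measurable_realfun.

Set Implicit Arguments.
Unset Strict Implicit.
Unset Printing Implicit Defensive.

Import Order.TTheory GRing.Theory Num.Theory.
Import numFieldNormedType.Exports.

Local Open Scope classical_set_scope.
Local Open Scope ring_scope.

Notation "{ 'mpoly' T [ n ] }" := (mpoly n T) : type_scope.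

Section lebesgue_measure_tuple.
Context {R : realType}.

Definition cons_tuple d (xy : R * d.-tuple R) : d.+1.-tuple R :=
  [tuple of xy.1 :: xy.2].

Fixpoint lebesgue_tuple d : set (d.-tuple R) -> \bar R :=
  if d is d'.+1 then
    pushforward (lebesgue_measure \x @lebesgue_tuple d')%E (@cons_tuple d')
  else dirac [tuple].

Let split_tuple d (t : d.+1.-tuple R) : R * d.-tuple R :=
  (thead t, [tuple of behead t]).

Let cons_tupleK d : cancel (@cons_tuple d) (@split_tuple d).
Proof. by case=> x y; congr pair; exact/val_inj. Qed.

Let measurable_cons_tuple d : measurable_fun setT (@cons_tuple d).
Proof. exact: measurable_cons. Qed.

Let measurable_split_tuple d : measurable_fun setT (@split_tuple d).
Proof.
apply: measurable_fun_pair => /=; first exact: measurable_tnth.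
exact: measurable_behead.
Qed.

Let lebesgue_tuple_sigma_finite_measure d :
  exists m : {sigma_finite_measure set (d.-tuple R) -> \bar R},
    @lebesgue_tuple d = m.
Proof.
elim: d => [|d [m IH]]; first by exists (dirac [tuple]).
rewrite /= IH; set p := (lebesgue_measure \x m)%E; set M := pushforward _ _.
have M0 : M set0 = 0%E by rewrite /M /pushforward preimage_set0; exact: measure0.
have M_ge0 A : (0 <= M A)%E by rewrite /M /pushforward; exact: measure_ge0.
have M_add : semi_sigma_additive M.
  apply: (@measure_semi_sigma_additive _ _ _ (pushforward p (@cons_tuple d))).
  exact: measurable_cons_tuple.
have M_fin : sigma_finite setT M.
  have /sigma_finiteP[F [TF ndF Foo]] := sigma_finiteT (@lebesgue_measure R).
  have /sigma_finiteP[G [TG ndG Goo]] := sigma_finiteT m.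
  exists (fun n => @split_tuple d @^-1` (F n `*` G n)).
    rewrite -preimage_bigcup (_ : \bigcup_n _ = setT) ?preimage_setT//.
    apply/seteqP; split => // -[x y] _.
    have : (\bigcup_n F n) x by rewrite -TF.
    move=> [n _ Fnx].
    have : (\bigcup_n G n) y by rewrite -TG.
    move=> [k _ Gky]; exists (maxn n k) => //; split.
    - by move: x Fnx; exact/subsetPset/ndF/leq_maxl.
    - by move: y Gky; exact/subsetPset/ndG/leq_maxr.
  move=> n; have [mF Fn] := Foo n; have [mG Gn] := Goo n; split.
    rewrite -[X in measurable X]setTI; apply: measurable_split_tuple => //.
    exact: measurableX.
  rewrite /M /pushforward -comp_preimage (_ : _ \o _ = idfun); last first.
    by apply/funext => x /=; rewrite cons_tupleK.
  rewrite preimage_id /p product_measure1E// lte_mul_pinfty// ge0_fin_numE//.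
move: M0 M_ge0 M_add M_fin; move: M => {p} M M0 M_ge0 M_add M_fin.
pose mM := isMeasure.Build _ _ _ M M0 M_ge0 M_add.
pose m' : {measure set (d.+1.-tuple R) -> \bar R} := HB.pack M mM.
pose sM := Measure_isSigmaFinite.Build _ _ _ m' M_fin.
by exists (HB.pack_for {sigma_finite_measure set (d.+1.-tuple R) -> \bar R} M mM sM).
Qed.

Section instances.
Variable d : nat.

Let lebesgue_tuple0 : @lebesgue_tuple d set0 = 0%E.
Proof.
by have [m ->] := lebesgue_tuple_sigma_finite_measure d; exact: measure0.
Qed.

Let lebesgue_tuple_ge0 A : (0 <= @lebesgue_tuple d A)%E.
Proof.
by have [m ->] := lebesgue_tuple_sigma_finite_measure d; exact: measure_ge0.
Qed.

Let lebesgue_tuple_sigma_additive : semi_sigma_additive (@lebesgue_tuple d).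
Proof.
have [m ->] := lebesgue_tuple_sigma_finite_measure d.
exact: measure_semi_sigma_additive.
Qed.

HB.instance Definition _ := isMeasure.Build _ _ _ (@lebesgue_tuple d)
  lebesgue_tuple0 lebesgue_tuple_ge0 lebesgue_tuple_sigma_additive.

Let lebesgue_tuple_sigma_finite : sigma_finite setT (@lebesgue_tuple d).
Proof.
by have [m ->] := lebesgue_tuple_sigma_finite_measure d; exact: sigma_finiteT.
Qed.

HB.instance Definition _ := Measure_isSigmaFinite.Build _ _ _
  (@lebesgue_tuple d) lebesgue_tuple_sigma_finite.

End instances.
End lebesgue_measure_tuple.

Arguments lebesgue_tuple {R} d A.

Section ball_sphere.
Context {R : realType} {d : nat}.
Implicit Types (x : d.-tuple R) (A : set (d.-tuple R)).

Definition enorm x : R := Num.sqrt (\sum_(i < d) tnth x i ^+ 2).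

Definition eball : set (d.-tuple R) := [set x | enorm x <= 1].

Definition esphere : set (d.-tuple R) := [set x | enorm x = 1].

Definition radial_proj x : d.-tuple R := [tuple tnth x i / enorm x | i < d].

(* The part in B^d \ {0} of the cone with apex 0 spanned by A `&` esphere. *)
Definition cone A : set (d.-tuple R) :=
  [set x | 0 < enorm x <= 1 /\ A (radial_proj x)].

(* In polar coordinates dx = r^(d-1) dr dw, so that the cone over a subset A of
   the sphere has volume w(A) / d. This is the usual definition of the surface
   measure w of the sphere; for d = 1 it gives mass 1 to both -1 and 1. As a
   measure on R^d it is carried by the sphere. *)
Definition surface_measure A : \bar R :=
  (d%:R%:E * lebesgue_tuple d (cone A))%E.

Let surface_measure0 : surface_measure set0 = 0%E.
Proof.
rewrite /surface_measure (_ : cone set0 = set0) ?measure0 ?mule0//.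
by apply/seteqP; split => // x [].
Qed.

Let surface_measure_ge0 A : (0 <= surface_measure A)%E.
Proof. by rewrite /surface_measure mule_ge0// lee_fin. Qed.

Let measurable_enorm : measurable_fun setT enorm.
Proof.
rewrite (_ : enorm = fun x => (\sum_(i < d) tnth x i ^+ 2) `^ 2^-1).
  apply: (measurableT_comp (measurable_powR _)).
  by apply: measurable_sum => i; apply: measurable_funX; exact: measurable_tnth.
by apply/funext => x; rewrite powR12_sqrt// sumr_ge0// => i _; exact: sqr_ge0.
Qed.

Let measurable_radial_proj : measurable_fun setT radial_proj.
Proof.
apply/measurable_fun_tnthP => i; rewrite /comp /radial_proj /=.
under eq_fun do rewrite tnth_mktuple -powR_inv1 ?sqrtr_ge0//.
apply: measurable_funM; first exact: measurable_tnth.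
exact: (measurableT_comp (measurable_powR _) measurable_enorm).
Qed.

Let measurable_cone A : measurable A -> measurable (cone A).
Proof.
move=> mA; rewrite (_ : cone A =
    enorm @^-1` `]0, 1]%classic `&` radial_proj @^-1` A).
  apply: measurableI; rewrite -[X in measurable X]setTI.
    exact: measurable_enorm.
  exact: measurable_radial_proj.
by apply/seteqP; split => x /=; rewrite in_itv.
Qed.

Let surface_measure_sigma_additive : semi_sigma_additive surface_measure.
Proof.
move=> F mF tF mUF; rewrite /surface_measure.
have -> : cone (\bigcup_n F n) = \bigcup_n cone (F n).
  by apply/seteqP; split=> x [] => [? [n _ ?]|n _ [? ?]]; [|split=> //]; exists n.
have mcF n : measurable (cone (F n)) by exact: measurable_cone.
under eq_fun do rewrite -ge0_sume_distrr//.
apply: cvgeZl => //; apply: measure_semi_sigma_additive => //.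
  apply/trivIsetP => i j _ _ ij; apply/seteqP; split => // x [[_ xi] [_ xj]].
  have : (F i `&` F j) (radial_proj x) by [].
  by move/trivIsetP: tF => /(_ _ _ Logic.I Logic.I ij) ->.
exact: bigcup_measurable.
Qed.

HB.instance Definition _ := isMeasure.Build _ _ _ surface_measure
  surface_measure0 surface_measure_ge0 surface_measure_sigma_additive.

End ball_sphere.

Arguments eball : clear implicits.
Arguments esphere : clear implicits.
Arguments surface_measure : clear implicits.

Section operators.
Context {R : realType} {d : nat}.
Implicit Types (p f g : {mpoly R[d]}) (mu : R).

Definition laplacian p : {mpoly R[d]} :=
  \sum_(i < d) mderiv i (mderiv i p).

Definition euler p : {mpoly R[d]} :=
  \sum_(i < d) mpolyX R (mnm1 i) * mderiv i p.

Definition Lop mu p : {mpoly R[d]} :=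
  laplacian p - euler (euler p) - (2 * mu + d%:R) *: euler p.

Definition grad_dot f g (x : d.-tuple R) : R :=
  \sum_(i < d) meval (tnth x) (mderiv i f) * meval (tnth x) (mderiv i g).

Definition omega : R := \int[surface_measure R d]_(x in esphere R d) 1.

Definition inner_m1 (lambda : R) f g : R :=
  lambda / omega * (\int[lebesgue_tuple d]_(x in eball R d) grad_dot f g x)
  + omega^-1 * (\int[surface_measure R d]_(x in esphere R d)
                  (meval (tnth x) f * meval (tnth x) g)).

(* msize p is the total degree of p plus 1, and 0 for p = 0. *)
Definition orthopoly_m1 (lambda : R) (n : nat) : set {mpoly R[d]} :=
  [set p | (msize p <= n.+1)%N /\
    forall g, (msize g <= n)%N -> inner_m1 lambda p g = 0].

End operators.

Arguments omega : clear implicits.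

Definition eigval {R : realType} (d : nat) (mu : R) (n : nat) : R :=
  - (n%:R * (n%:R + 2 * mu + d%:R)).

Section linear_algebra.
Context {K : fieldType} {V : lmodType K}.
Implicit Types B : set V.

Definition lin_indep B := forall (s : seq V) (c : V -> K), uniq s ->
  {in s, forall v, B v} -> \sum_(v <- s) c v *: v = 0 ->
  {in s, forall v, c v = 0}.

Definition spans B := forall w : V, exists (s : seq V) (c : V -> K),
  {in s, forall v, B v} /\ w = \sum_(v <- s) c v *: v.

Definition hamel_basis B := lin_indep B /\ spans B.

Definition eigenvector (L : V -> V) (v : V) :=
  v != 0 /\ exists a : K, L v = a *: v.

End linear_algebra.

(* Main.v *)
Require Import Defs.
From HB Require Import structures.
From mathcomp Require Import all_boot all_order all_algebra.
From mathcomp Require Import -(notations) mpoly.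
From mathcomp Require Import all_classical all_reals all_analysis.
From mathcomp Require Import measurable_realfun.
From mathcomp Require Import ring lra zify.

(** The operator [L = Lop (-1)] preserves the degree filtration, and on
    polynomials of degree at most [n] it acts as multiplication by
    [eigval d (-1) n] up to terms of degree less than [n]. If [L] is moreover
    symmetric for the Sobolev inner product, then for [P] orthogonal to all
    polynomials of degree less than [n] the difference
    [Q = L P - eigval d (-1) n *: P] has degree less than [n] and is still
    orthogonal to that space, hence to itself, and [Q = 0] because the inner
    product is definite ([sobolev_orthogonal_eigen]).

    Symmetry splits into two classical facts. On the sphere [L] restricts to
    the Laplace-Beltrami operator, half the sum of the squares of the
    infinitesimal rotations [drot i j] ([sphere_Lop_sym]). Inside the ball,
    [mderiv k] carries [L] to [Lop 0] minus a constant, and [Lop 0] is the sum of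
    the divergence form operator with weight [1 - rho] and of the same
    spherical operator, where [rho] is the squared norm ([ball_Lop0_sym]).

    All of this, and definiteness, only needs a few properties of the two
    moment functionals: [B], the integral over the ball, kills the derivatives
    of multiples of [1 - rho]; [S], the integral over the sphere, kills the
    multiples of [1 - rho] and the image of every [drot i j]; both are
    nonnegative on squares, with positive mass. That [B] also
    kills [drot i j h] is deduced algebraically ([ball_drot]), and so is the
    definiteness of [B] ([ball_definite]).

    The property of [B] is Fubini's theorem and the fundamental theorem of
    calculus on each chord parallel to an axis, at both ends of which
    [1 - rho] vanishes ([ball_integral_div]). The rotation invariance of [S] is
    reduced to that of [B]: an integral over the sphere is an integral of
    [h (x / |x|)] over the ball, which for homogeneous [h] is a dominated
    limit of integrals of [h] times polynomials in [rho] ([sphere_drot]).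

    For the second claim, since the Laplacian lowers the degree by two, an
    eigenfunction with leading term a given monomial can be written explicitly
    as a combination of the iterated Laplacians of that monomial, and such a
    family is triangular with respect to the monomials ([eigpoly_basis]). *)

Set Implicit Arguments.
Unset Strict Implicit.
Unset Printing Implicit Defensive.

Import Order.TTheory GRing.Theory Num.Theory.
Import numFieldNormedType.Exports.

Local Open Scope classical_set_scope.
Local Open Scope ring_scope.

(** * Derivations of the polynomial ring *)

Section derivations.
Context {R : realType} {d : nat}.
Implicit Types (p q f g h u v : {mpoly R[d]}) (i j k : 'I_d).

Local Notation "''X_' i" := (mpolyX R (mnm1 i)) (at level 8, i at level 2, format "''X_' i").

Definition derivation (D : {mpoly R[d]} -> {mpoly R[d]}) :=
  forall p q, D (p * q) = D p * q + p * D q.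

Lemma derivation_exp D p n : derivation D -> D (p ^+ n) = n%:R * p ^+ n.-1 * D p.
Proof.
move=> Dm.
have D1 : D 1 = 0.
  by have := Dm 1 1; rewrite !mulr1 mul1r -[LHS]addr0 => /addrI.
elim: n => [|n IH]; first by rewrite expr0 D1 !mul0r.
rewrite exprS Dm IH; case: n {IH} => [|n] /=; first by rewrite expr0; ring.
by rewrite !exprS; ring.
Qed.

Definition sqnorm : {mpoly R[d]} := \sum_(i < d) 'X_i * 'X_i.

Local Notation rho := sqnorm.

(** The vector field that generates the rotations of the coordinate plane
    [(i, j)]; it is tangent to every sphere centred at the origin. *)
Definition drot i j p : {mpoly R[d]} := 'X_i * mderiv j p - 'X_j * mderiv i p.

Lemma mderiv_derivation i : derivation (mderiv i).
Proof. exact: mderivM. Qed.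

Lemma mderivXU i j : mderiv i 'X_j = (i == j)%:R.
Proof.
rewrite mderivX mnm1E eq_sym; case: eqP => [->|_]; last by rewrite scale0r.
rewrite (_ : mnm_sub _ _ = mnm0) ?mpolyX0 ?scale1r//.
by apply/mnmP => k; rewrite mnmBE subnn mnm0E.
Qed.

Lemma sum_delta (F : 'I_d -> {mpoly R[d]}) i : \sum_j (i == j)%:R * F j = F i.
Proof.
rewrite (bigD1 i)//= eqxx mul1r big1 ?addr0// => j ij.
by rewrite eq_sym (negbTE ij) mul0r.
Qed.

Lemma mderiv_rho i : mderiv i rho = 2 * 'X_i.
Proof.
rewrite /sqnorm raddf_sum /=.
under eq_bigr do rewrite mderivM mderivXU mulrC -mulrDr mulrC mulrDl.
by rewrite big_split /= sum_delta mulr_natl mulr2n.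
Qed.

Lemma euler_derivation : derivation euler.
Proof.
move=> p q; rewrite /euler mulr_suml mulr_sumr -big_split /=.
by apply: eq_bigr => i _; rewrite mderivM; ring.
Qed.

Lemma drot_derivation i j : derivation (drot i j).
Proof. by move=> p q; rewrite /drot !mderivM; ring. Qed.

Lemma euler_rho : euler rho = 2 * rho.
Proof.
rewrite /euler /sqnorm mulr_sumr; apply: eq_bigr => i _.
by rewrite mderiv_rho; ring.
Qed.

Lemma drot_rho i j : drot i j rho = 0.
Proof. by rewrite /drot !mderiv_rho; ring. Qed.

Lemma drot_linear i j : linear (drot i j).
Proof.
move=> c p q; rewrite /drot !linearP /= scalerBr !mulrDr -!scalerAr.
by rewrite opprD addrACA.
Qed.
HB.instance Definition _ i j := GRing.isLinear.Build R {mpoly R[d]} {mpoly R[d]}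
  _ (drot i j) (drot_linear i j).

Lemma euler_linear : linear (@euler R d).
Proof.
move=> c p q; rewrite /euler scaler_sumr -big_split /=; apply: eq_bigr => i _.
by rewrite linearP /= mulrDr scalerAr.
Qed.
HB.instance Definition _ := GRing.isLinear.Build R {mpoly R[d]} {mpoly R[d]}
  _ euler euler_linear.

Lemma laplacian_linear : linear (@laplacian R d).
Proof.
move=> c p q; rewrite /laplacian scaler_sumr -big_split /=; apply: eq_bigr => i _.
by rewrite !linearP.
Qed.
HB.instance Definition _ := GRing.isLinear.Build R {mpoly R[d]} {mpoly R[d]}
  _ laplacian laplacian_linear.

Lemma Lop_linear mu : linear (@Lop R d mu).
Proof.
move=> c p q; rewrite /Lop !linearP /= -!mul_mpolyC; ring.
Qed.
HB.instance Definition _ mu := GRing.isLinear.Build R {mpoly R[d]} {mpoly R[d]}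
  _ (Lop mu) (Lop_linear mu).

Lemma mderiv_euler k p : mderiv k (euler p) = mderiv k p + euler (mderiv k p).
Proof.
rewrite /euler raddf_sum /=.
under eq_bigr => i _ do rewrite mderivM mderivXU mderiv_comm.
by rewrite big_split /= sum_delta.
Qed.

Lemma mderiv_laplacian k p : mderiv k (laplacian p) = laplacian (mderiv k p).
Proof.
rewrite /laplacian raddf_sum /=; apply: eq_bigr => i _.
by rewrite (mderiv_comm i k (mderiv i p)) (mderiv_comm i k p).
Qed.

(** Differentiation raises the parameter of [Lop] by one, because
    [mderiv k] commutes with [euler] up to [mderiv k]. This is how the gradient
    part of the Sobolev product meets an operator attached to Lebesgue measure
    on the ball. *)
Lemma mderiv_Lop k p :
  mderiv k (Lop (-1) p) = Lop 0 (mderiv k p) - (d%:R - 1) *: mderiv k p.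
Proof.
rewrite /Lop !linearB /= linearZ /= mderiv_laplacian !mderiv_euler.
rewrite !linearD /= -!mul_mpolyC.
rewrite !(rmorphD, rmorphB, rmorphM, rmorphN, rmorph1, rmorph0, rmorph_nat)/=.
by ring.
Qed.

(** Twice the Laplace-Beltrami operator of the unit sphere: each coordinate
    plane is counted twice, as [(i, j)] and as [(j, i)]. *)
Definition sphlap p : {mpoly R[d]} := \sum_i \sum_j drot i j (drot i j p).

(** The spherical decomposition of the Laplacian. At [rho = 1] the right-hand
    side is [2 * Lop (-1) p]. *)
Lemma sphlapE p :
  sphlap p = 2 * (rho * laplacian p - euler (euler p) - (d%:R - 2) * euler p).
Proof.
pose H i j : {mpoly R[d]} := mderiv i (mderiv j p).
have E2 : euler (euler p) = euler p + \sum_i \sum_j 'X_i * 'X_j * H i j.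
  rewrite {1}/euler; under eq_bigr => i _ do rewrite mderiv_euler mulrDr.
  rewrite big_split /=; congr +%R; apply: eq_bigr => i _.
  rewrite /euler mulr_sumr; apply: eq_bigr => j _.
  by rewrite /H mderiv_comm mulrA.
have rotE i j : drot i j (drot i j p) =
    'X_i * 'X_i * H j j + 'X_j * 'X_j * H i i - ('X_i * 'X_j * H i j) *+ 2
    + (i == j)%:R * ('X_i * mderiv j p) + (i == j)%:R * ('X_j * mderiv i p)
    - 'X_i * mderiv i p - 'X_j * mderiv j p.
  rewrite /drot !linearB /= !mderivM !mderivXU !eqxx /H (mderiv_comm j i) (eq_sym j i).
  rewrite mulr1n; ring.
rewrite /sphlap; under eq_bigr => i _ do under eq_bigr => j _ do rewrite rotE.
under eq_bigr => i _.
  rewrite !(sumrB, big_split) /= !sum_delta sumr_const card_ord.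
  rewrite -!mulr_suml -!mulr_sumr.
  over.
rewrite !(sumrB, big_split) /= -!mulr_suml -!mulr_sumr sumr_const card_ord sumrMnl.
rewrite E2.
have -> : \sum_i 'X_i * 'X_i = rho by [].
have -> : \sum_i H i i = laplacian p by [].
have -> : \sum_i 'X_i * mderiv i p = euler p by [].
rewrite -!(mulr_natl (euler p)).
ring.
Qed.

End derivations.

(** * Degree filtration *)

Section degree.
Context {R : realType} {d : nat}.
Implicit Types (p q f g : {mpoly R[d]}) (i : 'I_d).

Local Notation msize p := (mmeasure mdeg p).
Local Notation "p @_ m" := (mcoeff m p) (at level 3, m at level 2, format "p @_ m") : ring_scope.

Lemma msize_leP p n : (msize p <= n)%N <-> forall m, (n <= mdeg m)%N -> p@_m = 0.
Proof.
split=> [pn m nm|p0].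
  by apply: memN_msupp_eq0; apply: msize_mdeg_ge; exact: leq_trans nm.
rewrite msizeE; apply/bigmax_leqP_seq => m mp _; rewrite ltnNge; apply/negP => nm.
by move: mp; rewrite mcoeff_msupp p0// eqxx.
Qed.

Lemma msize_mderiv i p n : (msize p <= n)%N -> (msize (mderiv i p) <= n.-1)%N.
Proof.
move=> /msize_leP p0; apply/msize_leP => m nm; rewrite mcoeff_deriv p0 ?mul0rn//.
by rewrite mdegD mdeg1 addn1; apply: leq_trans (leqSpred n) _; rewrite ltnS.
Qed.

Lemma mderiv_eq0_const p : (forall i, mderiv i p = 0) -> p = mpolyC d (p@_mnm0).
Proof.
move=> p0; apply/mpolyP => m; rewrite mcoeffC.
have [->|m0] := eqVneq m mnm0; first by rewrite mulr1.
rewrite mulr0; have [i mi] : exists i, (0 < m i)%N.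
  case: (pickP (fun i => 0 < m i)%N) => [i mi|mz]; first by exists i.
  case/eqP: m0; apply/mnmP => i; rewrite mnm0E; apply/eqP.
  by rewrite -leqn0 leqNgt mz.
(* The coefficient of [m] is read off from that of [m - U_i] in [mderiv i p]. *)
have := mcoeff_deriv i (mnm_sub m (mnm1 i)) p.
rewrite p0 mcoeff0 (_ : mnm_add _ _ = m); last first.
  apply/mnmP => j; rewrite mnmDE mnmBE mnm1E subnK//.
  by case: eqP => // <-.
by move=> /esym/eqP; rewrite mulrn_eq0/= => /eqP.
Qed.

Lemma euler_mpolyX (m : multinom d) :
  euler (mpolyX R m) = (mdeg m)%:R *: mpolyX R m.
Proof.
rewrite /euler mdegE natr_sum scaler_suml; apply: eq_bigr => i _.
rewrite mderivX -scalerAr -mpolyXD.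
have [->|mi] := posnP (m i); first by rewrite !scale0r.
congr (_ *: mpolyX R _); apply/mnmP => j; rewrite mnmDE mnmBE mnm1E subnKC//.
by case: eqP => // <-.
Qed.

Lemma mcoeff_euler m p : (euler p)@_m = (mdeg m)%:R * p@_m.
Proof.
elim/mpolyind: p => [|c k p _ _ IH]; first by rewrite raddf0 mcoeff0 mulr0.
rewrite linearP /= !mcoeffD !mcoeffZ IH mulrDr; congr (_ + _).
rewrite euler_mpolyX mcoeffZ mcoeffX; case: eqP => [->|_]; last by rewrite !mulr0.
by ring.
Qed.

Lemma msize_laplacian p n : (msize p <= n)%N -> (msize (laplacian p) <= n.-2)%N.
Proof.
move=> pn; apply: leq_trans (msize_sum _ _ _) _; apply/bigmax_leqP => i _.
by do 2!apply: msize_mderiv.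
Qed.

Lemma msize_laplacian_lt p n :
  (msize p <= n.+1)%N -> (msize (laplacian p) <= n)%N.
Proof. by move=> /msize_laplacian/leq_trans; apply; exact: leq_pred. Qed.

(** Since [euler] is diagonal on monomials, [Lop mu] is triangular with the
    numbers [eigval] on the diagonal, the Laplacian being the part that lowers
    the degree. *)
Lemma mcoeff_Lop mu m p :
  (Lop mu p)@_m = (laplacian p)@_m + eigval d mu (mdeg m) * p@_m.
Proof. by rewrite /Lop !mcoeffB mcoeffZ !mcoeff_euler /eigval; ring. Qed.

Lemma msize_Lop mu p n : (msize p <= n)%N -> (msize (Lop mu p) <= n)%N.
Proof.
move=> pn; apply/msize_leP => m nm; rewrite mcoeff_Lop.
rewrite (proj1 (msize_leP p n))// mulr0 addr0.
by rewrite (proj1 (msize_leP (laplacian p) n))// msize_laplacian_lt// leqW.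
Qed.

Lemma msize_Lop_eig mu p n : (msize p <= n.+1)%N ->
  (msize (Lop mu p - eigval d mu n *: p) <= n)%N.
Proof.
move=> pn; apply/msize_leP => m nm; rewrite mcoeffB mcoeffZ mcoeff_Lop.
rewrite (proj1 (msize_leP (laplacian p) n)) ?msize_laplacian_lt// add0r.
have [->|ne] := eqVneq (mdeg m) n; first by rewrite subrr.
by rewrite (proj1 (msize_leP p n.+1)) ?mulr0 ?subrr// ltn_neqAle eq_sym ne.
Qed.

End degree.

(** * Moment functionals of the ball and the sphere *)

Section functionals.
Context {R : realType} {d : nat}.
Implicit Types (p q f g h u v : {mpoly R[d]}) (i j k : 'I_d).

Local Notation msize p := (mmeasure mdeg p).
Local Notation "''X_' i" := (mpolyX R (mnm1 i)) (at level 8, i at level 2, format "''X_' i").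
Local Notation rho := (@sqnorm R d).
Local Notation w := (1 - rho).
Local Notation functional := {linear {mpoly R[d]} -> R | *%R}.

Lemma functionalD (F : functional) p q : F (p + q) = F p + F q.
Proof. exact: raddfD. Qed.

Lemma functionalB (F : functional) p q : F (p - q) = F p - F q.
Proof. exact: raddfB. Qed.

Lemma functionalZ (F : functional) c p : F (c *: p) = c * F p.
Proof. exact: linearZ. Qed.

Lemma functional_sum (F : functional) (I : finType) (G : I -> {mpoly R[d]}) :
  F (\sum_i G i) = \sum_i F (G i).
Proof. exact: raddf_sum. Qed.

Lemma functional_mulC (F : functional) c p : F (mpolyC d c * p) = c * F p.
Proof. by rewrite mul_mpolyC linearZ. Qed.

Lemma functional_natM (F : functional) n p : F (n%:R * p) = n%:R * F p.
Proof. by rewrite !mulr_natl raddfMn. Qed.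

(** Valid for a semidefinite [F]; it is used both to bound moments and to see
    that a polynomial of norm zero pairs to zero with everything. *)
Lemma cauchy_schwarz (F : functional) p q : (forall p, 0 <= F (p * p)) ->
  F (p * q) ^+ 2 <= F (p * p) * F (q * q).
Proof.
move=> F_ge0; set a := F (p * p); set b := F (p * q); set c := F (q * q).
have quad x y : 0 <= x ^+ 2 * a + 2 * (x * y * b) + y ^+ 2 * c.
  suff -> : x ^+ 2 * a + 2 * (x * y * b) + y ^+ 2 * c =
      F ((x *: p + y *: q) * (x *: p + y *: q)) by [].
  rewrite /a /b /c.
  have -> : (x *: p + y *: q) * (x *: p + y *: q) =
      x ^+ 2 *: (p * p) + (2 * (x * y)) *: (p * q) + y ^+ 2 *: (q * q).
    by rewrite -!mul_mpolyC !rmorphM /= rmorph_nat; ring.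
  by rewrite !linearD /= !linearZ /=; ring.
have a0 : 0 <= a := F_ge0 p.
have [az|ane] := eqVneq a 0.
  have [->|bne] := eqVneq b 0; first by rewrite az expr2 !mul0r.
  (* When [a = 0] the quadratic form is affine in [x]: make it equal to -1. *)
  have := quad (- (c + 1) / (2 * b)) 1.
  have -> : 2 * (- (c + 1) / (2 * b) * 1 * b) = - (c + 1) by field.
  rewrite az mulr0; lra.
have agt : 0 < a by rewrite lt_def ane.
(* The minimiser of the quadratic form, up to the factor [a]. *)
have := quad (- b) a.
have -> : (- b) ^+ 2 * a + 2 * (- b * a * b) + a ^+ 2 * c = a * (a * c - b ^+ 2) by ring.
by rewrite pmulr_rge0// subr_ge0.
Qed.

(** A derivation whose image is killed by [F] is antisymmetric for the pairing
    [F (u * v)], so that a sum of squares of such derivations is symmetric. *)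
Lemma sphlap_sym (F : functional) u v : (forall i j h, F (drot i j h) = 0) ->
  F (v * sphlap u) = F (u * sphlap v).
Proof.
move=> Frot.
suff H a b : F (b * sphlap a) = - \sum_i \sum_j F (drot i j a * drot i j b).
  by rewrite !H; congr (- _); apply: eq_bigr => i _; apply: eq_bigr => j _; rewrite mulrC.
rewrite /sphlap mulr_sumr raddf_sum -sumrN; apply: eq_bigr => i _.
rewrite mulr_sumr raddf_sum -sumrN; apply: eq_bigr => j _.
have := Frot i j (b * drot i j a); rewrite drot_derivation raddfD /= => /eqP.
by rewrite addrC addr_eq0 mulrC => /eqP; rewrite mulrC => ->; rewrite mulrC.
Qed.

(** [F] stands for the integral over the ball, and [F_div] for the divergence
    theorem applied to vector fields that vanish on the sphere. *)
Section ball.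
Variable F : functional.
Hypothesis F_div : forall i h, F (mderiv i (w * h)) = 0.
Hypothesis F_ge0 : forall p, 0 <= F (p * p).

(** The divergence theorem for the radial field with coefficient
    [(1 - rho) * u]. It yields the recurrences for the moments of [rho] and of
    [1 - rho] below. *)
Lemma ball_euler u : F (d%:R * (w * u) + euler (w * u)) = 0.
Proof.
have -> : d%:R * (w * u) + euler (w * u) = \sum_i mderiv i (w * ('X_i * u)).
  under eq_bigr => i _.
    rewrite mulrCA mderivM mderivXU eqxx mulr1n mul1r; over.
  by rewrite big_split/= sumr_const card_ord mulr_natl.
by rewrite raddf_sum big1 //= => i _; rewrite F_div.
Qed.

(** In particular the moments of [rho ^+ N] tend to zero, which says that the
    boundary sphere carries no mass for [F]. *)
Lemma ball_rho_exp N : (d%:R + 2 * N%:R) * F (rho ^+ N) = d%:R * F 1.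
Proof.
elim: N => [|N IH]; first by rewrite expr0 mulr0 addr0.
have eulerXn n : euler (rho ^+ n) = (2 * n%:R) *: rho ^+ n.
  rewrite (derivation_exp _ _ euler_derivation) euler_rho -mul_mpolyC rmorphM !rmorph_nat.
  by case: n => [|n]; rewrite ?exprS/=; ring.
have := ball_euler (rho ^+ N).
rewrite mulrBl mul1r -exprS linearB /= !eulerXn mulrBr functionalD !functionalB.
rewrite !functional_natM !functionalZ.
move=> e; rewrite -IH; apply/eqP; rewrite -subr_eq0 -oppr_eq0 -[X in _ == X]e.
by apply/eqP; rewrite -![N.+1%:R]natr1; ring.
Qed.

(** A rotation field is divergence free and commutes with functions of [rho],
    so that [F] kills [(1 - rho) * drot i j u] for every [u]. Hence the value
    at [drot i j h] does not change when it is multiplied by [rho ^+ N], and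
    it is zero by Cauchy-Schwarz, since the moments of [rho ^+ (2 N)] tend to
    zero. *)
Lemma ball_drot i j h : F (drot i j h) = 0.
Proof.
set q := drot i j h.
have rotE u : drot i j u = mderiv j ('X_i * u) - mderiv i ('X_j * u).
  by rewrite !mderivM !mderivXU [j == i]eq_sym /drot; ring.
have step u : F (w * drot i j u) = 0.
  have -> : w * drot i j u = drot i j (w * u).
    by rewrite drot_derivation linearB /= drot_rho /drot -[1]/(mpolyC d 1) !mderivC; ring.
  by rewrite rotE !(mulrCA (mpolyX _ _)) raddfB /= !F_div subrr.
have qN N : F (rho ^+ N * q) = F q.
  elim: N => [|N IH]; first by rewrite expr0 mul1r.
  rewrite -IH; apply/eqP; rewrite eq_sym -subr_eq0 -raddfB /= exprS.
  have -> : rho ^+ N * q - rho * rho ^+ N * q = w * drot i j (rho ^+ N * h).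
    rewrite drot_derivation (derivation_exp _ _ (@drot_derivation _ _ i j)) drot_rho /q.
    by ring.
  by rewrite step.
have bound N : (d%:R + 4 * N%:R) * F q ^+ 2 <= d%:R * F 1 * F (q * q).
  have -> : 4 * N%:R = 2 * (N + N)%:R :> R by rewrite natrD; ring.
  rewrite -(ball_rho_exp (N + N)) -mulrA ler_wpM2l ?addr_ge0 ?mulr_ge0//.
  by rewrite -{1}(qN N) exprD; exact: cauchy_schwarz.
have [//|F0] := eqVneq (F q) 0.
have Fgt : 0 < F q ^+ 2 by rewrite lt_def sqrf_eq0 F0 sqr_ge0.
set M := d%:R * F 1 * F (q * q) in bound.
have [N MN] : exists N, M / F q ^+ 2 < N%:R.
  exists (Num.truncn (M / F q ^+ 2)).+1; exact: truncnS_gt.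
have : M < N%:R * F q ^+ 2 by rewrite -ltr_pdivrMr.
have := bound N.
have : 0 <= d%:R * F q ^+ 2 by rewrite mulr_ge0 ?ler0n ?sqr_ge0.
have : 0 <= N%:R * F q ^+ 2 by rewrite mulr_ge0 ?ler0n ?sqr_ge0.
rewrite mulrDl -mulrA; lra.
Qed.

(** [Lop 0] is the divergence form operator of weight [1 - rho], which
    vanishes on the boundary, plus half of [sphlap]. *)
Lemma ball_Lop0_sym u v : F (v * Lop 0 u) = F (u * Lop 0 v).
Proof.
have L0E a : 2 * Lop 0 a = 2 * (\sum_i mderiv i (w * mderiv i a)) + sphlap a.
  under eq_bigr => i _ do rewrite mderivM raddfB /= mderiv_rho.
  rewrite sphlapE big_split /= -mulr_sumr /Lop.
  have -> : \sum_i (mderiv i 1 - 2 * 'X_i) * mderiv i a = - (2 * euler a).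
    rewrite /euler mulr_sumr -sumrN; apply: eq_bigr => i _.
    by rewrite -[1]/(mpolyC d 1) mderivC; ring.
  rewrite -[\sum_i _]/(laplacian a) -mul_mpolyC mulr0 add0r rmorph_nat.
  by ring.
have parts a b i : F (b * mderiv i (w * mderiv i a)) = - F (w * (mderiv i a * mderiv i b)).
  have := F_div i (b * mderiv i a).
  rewrite mulrCA mderivM raddfD /= => /eqP; rewrite addrC addr_eq0 => /eqP ->.
  by congr (- F _); ring.
suff : 2 * F (v * Lop 0 u) = 2 * F (u * Lop 0 v) by lra.
rewrite -!functional_natM !(mulrCA 2%:R) !L0E !mulrDr !raddfD /= (sphlap_sym _ _ ball_drot).
congr (_ + _); rewrite !(mulrCA _ 2%:R) !functional_natM; congr (_ * _).
rewrite !mulr_sumr !functional_sum; apply: eq_bigr => i _.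
by rewrite !parts [mderiv i u * _]mulrC.
Qed.

Hypothesis F1 : 0 < F 1.

Lemma ball_exp_gt0 n : 0 < F (w ^+ n).
Proof.
elim: n => [|n IH]; first by rewrite expr0.
have := ball_euler (w ^+ n).
rewrite -exprS (derivation_exp _ _ euler_derivation) /=.
rewrite linearB /= euler_rho.
have -> : euler 1 = 0 :> {mpoly R[d]}.
  by rewrite /euler big1// => i _; rewrite -[1]/(mpolyC d 1) mderivC mulr0.
have -> : n.+1%:R * w ^+ n * (0 - 2 * rho) = (2 * n.+1)%:R * (w ^+ n.+1 - w ^+ n).
  by rewrite exprS natrM; ring.
rewrite raddfD /= !functional_natM raddfB /= => e.
have : (d + 2 * n.+1)%:R * F (w ^+ n.+1) = (2 * n.+1)%:R * F (w ^+ n).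
  by move: e; rewrite natrD; lra.
move=> e'; have : 0 < (d + 2 * n.+1)%:R * F (w ^+ n.+1) by rewrite e' mulr_gt0.
by rewrite pmulr_rgt0// ltr0n addnS.
Qed.

(** Induction on the degree, for all the weights [(1 - rho) ^+ n] together. If
    the weighted norm of [p] vanishes, then [(1 - rho) ^+ n * p] pairs to zero
    with all polynomials, and the divergence theorem transfers this to the
    partial derivatives of [p] with the weight [(1 - rho) ^+ n.+1]. So these
    derivatives vanish and [p] is constant. *)
Lemma ball_definite q : F (q * q) = 0 -> q = 0.
Proof.
suff H N n p : (msize p <= N)%N -> F ((w ^+ n * p) * (w ^+ n * p)) = 0 -> p = 0.
  by move=> q0; apply: (H (msize q) 0%N) => //; rewrite expr0 mul1r.
elim: N n p => [|N IH] n p; first by rewrite leqn0 msize_poly_eq0 => /eqP.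
move=> pN p0.
have orth g : F (w ^+ n * p * g) = 0.
  apply/eqP; rewrite -sqrf_eq0 eq_le sqr_ge0 andbT.
  by apply: le_trans (cauchy_schwarz _ _ F_ge0) _; rewrite p0 mul0r.
have dp0 i : mderiv i p = 0.
  apply: (IH n.+1); first exact: (msize_mderiv i pN).
  set g := w ^+ n.+1 * mderiv i p.
  have := F_div i (w ^+ n * (g * p)).
  rewrite mulrA -exprS mulrA mderivM raddfD /= => /eqP.
  have -> : mderiv i (w ^+ n.+1 * g) * p =
     w ^+ n * p * (n.+1%:R * mderiv i w * g + w * mderiv i g).
    rewrite mderivM (derivation_exp _ _ (mderiv_derivation i)) /= exprS.
    by ring.
  by rewrite orth add0r => /eqP <-; congr (F _); rewrite /g; ring.
rewrite (mderiv_eq0_const dp0) in p0 *.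
set c := mcoeff _ p in p0 *.
suff -> : c = 0 by rewrite mpolyC0.
move: p0; rewrite mulrACA -exprD -rmorphM /= mulrC functional_mulC.
move=> /eqP; rewrite mulf_eq0 (gt_eqF (ball_exp_gt0 _)) orbF -expr2 sqrf_eq0.
by move=> /eqP.
Qed.

End ball.

Section sphere.
Variable F : functional.
Hypothesis F_sphere : forall h, F (w * h) = 0.
Hypothesis F_drot : forall i j h, F (drot i j h) = 0.

Lemma sphere_Lop_sym f g : F (f * Lop (-1) g) = F (g * Lop (-1) f).
Proof.
have LE a b : 2 * F (b * Lop (-1) a) = F (b * sphlap a).
  have -> : b * sphlap a = 2 * (b * Lop (-1) a) - w * (2 * b * laplacian a).
    rewrite sphlapE /Lop -mul_mpolyC rmorphD rmorphM rmorphN rmorph1 !rmorph_nat.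
    by ring.
  by rewrite raddfB /= F_sphere subr0 functional_natM.
suff : 2 * F (f * Lop (-1) g) = 2 * F (g * Lop (-1) f) by lra.
by rewrite !LE sphlap_sym.
Qed.

End sphere.

(** The positive constants [c1] and [c2] stand for the normalisations
    [lambda / omega] and [omega^-1]. *)
Section sobolev.
Variables (B S : functional) (c1 c2 : R).
Hypothesis B_div : forall i h, B (mderiv i (w * h)) = 0.
Hypothesis B_ge0 : forall p, 0 <= B (p * p).
Hypothesis B1 : 0 < B 1.
Hypothesis S_sphere : forall h, S (w * h) = 0.
Hypothesis S_drot : forall i j h, S (drot i j h) = 0.
Hypothesis S_ge0 : forall p, 0 <= S (p * p).
Hypothesis S1 : 0 < S 1.
Hypotheses (c1_gt0 : 0 < c1) (c2_gt0 : 0 < c2).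

Definition sobolev f g :=
  c1 * B (\sum_i mderiv i f * mderiv i g) + c2 * S (f * g).

Lemma sobolevC f g : sobolev f g = sobolev g f.
Proof.
rewrite /sobolev [f * g]mulrC; congr (_ * B _ + _).
by apply: eq_bigr => i _; rewrite mulrC.
Qed.

Lemma sobolev_linear f : linear_for *%R (sobolev f).
Proof.
move=> a p q; rewrite /sobolev.
have -> : \sum_i mderiv i f * mderiv i (a *: p + q) =
    a *: (\sum_i mderiv i f * mderiv i p) + \sum_i mderiv i f * mderiv i q.
  rewrite scaler_sumr -big_split/=; apply: eq_bigr => i _.
  by rewrite linearP /= mulrDr scalerAr.
by rewrite mulrDr -scalerAr !linearP /=; ring.
Qed.

Lemma sobolev_Lop f g : sobolev f (Lop (-1) g) = sobolev (Lop (-1) f) g.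
Proof.
rewrite [RHS]sobolevC /sobolev (sphere_Lop_sym S_sphere S_drot); congr (c1 * _ + _).
have E a b : B (\sum_i mderiv i a * mderiv i (Lop (-1) b)) =
  \sum_i B (mderiv i a * Lop 0 (mderiv i b)) -
  \sum_i (d%:R - 1) * B (mderiv i a * mderiv i b).
  rewrite functional_sum -sumrB; apply: eq_bigr => i _.
  by rewrite mderiv_Lop mulrBr functionalB -scalerAr functionalZ.
rewrite !E; congr (_ - _); apply: eq_bigr => i _; last by rewrite [mderiv i f * _]mulrC.
exact: (ball_Lop0_sym B_div B_ge0).
Qed.

Lemma sobolev_definite f : sobolev f f = 0 -> f = 0.
Proof.
have Bsum_ge0 : 0 <= \sum_i B (mderiv i f * mderiv i f) by apply: sumr_ge0.
move=> /eqP; rewrite /sobolev raddf_sum /= paddr_eq0 ?mulr_ge0 ?(ltW c1_gt0) ?(ltW c2_gt0)//.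
rewrite 2!mulf_eq0 (gt_eqF c1_gt0) (gt_eqF c2_gt0) /= psumr_eq0// => /andP[/allP df /eqP].
rewrite (@mderiv_eq0_const _ _ f); last first.
  move=> i; apply: (ball_definite B_div B_ge0 B1); apply/eqP.
  by have := df i (mem_index_enum i).
set c := mcoeff _ f.
rewrite -[X in S (_ * X)]mulr1 mulrA -rmorphM /= functional_mulC => /eqP.
by rewrite mulf_eq0 -expr2 sqrf_eq0 [S 1 == 0]gt_eqF// orbF => /eqP ->; rewrite mpolyC0.
Qed.

Theorem sobolev_orthogonal_eigen n P : (msize P <= n.+1)%N ->
  (forall g, (msize g <= n)%N -> sobolev P g = 0) ->
  Lop (-1) P = eigval d (-1) n *: P.
Proof.
move=> Pn orth; apply/eqP; rewrite -subr_eq0; apply/eqP.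
set Q := Lop (-1) P - _.
have Qn : (msize Q <= n)%N by exact: msize_Lop_eig.
have QE g : sobolev g Q = sobolev g (Lop (-1) P) - eigval d (-1) n * sobolev g P.
  by rewrite /Q addrC -scaleNr sobolev_linear addrC mulNr.
apply: sobolev_definite.
by rewrite QE sobolev_Lop ![sobolev _ P]sobolevC !orth ?mulr0 ?subr0//; exact: msize_Lop.
Qed.

End sobolev.
End functionals.

(** * A basis of eigenfunctions *)

Section eigenbasis.
Context {R : realType} {d : nat}.
Hypothesis d_gt0 : (0 < d)%N.
Implicit Types (p q f g : {mpoly R[d]}) (i : 'I_d) (m : multinom d).

Local Notation msize p := (mmeasure mdeg p).
Local Notation "p @_ m" := (mcoeff m p) (at level 3, m at level 2, format "p @_ m") : ring_scope.
Local Notation lap j m := (iter j laplacian (mpolyX R m)).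

(** The Laplacian lowers the degree of homogeneity by two; therefore the
    iterated Laplacians of a monomial of degree [n] are eigenvectors of
    [euler] for [n], [n - 2], [n - 4] and so on. *)
Lemma euler_laplacian p : euler (laplacian p) = laplacian (euler p) - 2 *: laplacian p.
Proof.
have -> : laplacian (euler p) = euler (laplacian p) + 2 *: laplacian p.
  rewrite {1}/laplacian; under eq_bigr => i _.
    rewrite !(mderiv_euler, linearD) /= mderiv_euler; over.
  rewrite !big_split /= -[X in X + _]/(laplacian p).
  rewrite -[X in _ + (X + _)]/(laplacian p) -[laplacian p in RHS]/(\sum_i _).
  rewrite -linear_sum /= -/(laplacian p) scaler_nat mulr2n.
  by rewrite addrA addrC.
by rewrite addrK.
Qed.

Lemma euler_lap j m : euler (lap j m) = ((mdeg m)%:R - 2 * j%:R) *: lap j m.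
Proof.
elim: j => [|j IH]; first by rewrite /= euler_mpolyX mulr0 subr0.
rewrite iterS euler_laplacian IH linearZ /= -scalerBl; congr (_ *: _).
by rewrite -[j.+1%:R]natr1; ring.
Qed.

Lemma msize_lap j m : (msize (lap j m) <= (mdeg m).+1 - j.*2)%N.
Proof.
elim: j => [|j IH]; first by rewrite subn0 msizeX.
by rewrite iterS doubleS -addn2 subnDA subn2; apply: msize_laplacian.
Qed.

(** The coefficients solve [c_0 = 1] and
    [c_j.+1 * (eigval (n - 2 j - 2) - eigval n) + c_j = 0],
    where the difference of eigenvalues is
    [2 (j + 1) * (2 n - 2 (j + 1) + d - 2)]. It is nonzero as long as
    [2 j + 2 <= n], and for larger [j] the iterated Laplacian is zero. *)
Definition eigpoly_coef (n j : nat) : R :=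
  \prod_(i < j) - ((2 * i.+1%:R) * (2 * n%:R - 2 * i.+1%:R + d%:R - 2))^-1.

Definition eigpoly m := \sum_(j < (mdeg m).+1) eigpoly_coef (mdeg m) j *: lap j m.

Lemma Lop_lap j m : Lop (-1) (lap j m) = lap j.+1 m +
  (eigval d (-1) (mdeg m) + 2 * j%:R * (2 * (mdeg m)%:R - 2 * j%:R + d%:R - 2)) *: lap j m.
Proof.
rewrite /Lop euler_lap linearZ /= euler_lap; set t := (mdeg m)%:R - _.
rewrite !scalerA -addrA -opprD -scalerDl -scaleNr.
by congr (_ + _ *: _); rewrite /eigval /t; ring.
Qed.

Lemma eigpolyP m : Lop (-1) (eigpoly m) = eigval d (-1) (mdeg m) *: eigpoly m.
Proof.
set n := mdeg m.
pose a j : R := 2 * j%:R * (2 * n%:R - 2 * j%:R + d%:R - 2).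
apply/eqP; rewrite -subr_eq0; apply/eqP.
transitivity (\sum_(j < n.+1) (eigpoly_coef n j *: lap j.+1 m +
                               (a j * eigpoly_coef n j) *: lap j m)).
  rewrite /eigpoly linear_sum scaler_sumr -sumrB; apply: eq_bigr => j _.
  rewrite linearZ /= Lop_lap scalerDr -addrA; congr (_ + _).
  by rewrite !scalerA -scalerBl /a; congr (_ *: _); ring.
rewrite big_split /= big_ord_recr /= [X in _ + X]big_ord_recl /=.
rewrite /a mulr0 !mul0r scale0r add0r.
have lap0 j : (n < j.*2)%N -> lap j m = 0.
  move=> nj; apply/eqP; rewrite -msize_poly_eq0 -leqn0.
  by apply: leq_trans (msize_lap j m) _; rewrite leqn0 subn_eq0.
rewrite -iterS lap0 ?scaler0 ?addr0; last by rewrite doubleS -addnn; lia.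
rewrite -big_split big1//= => j _.
have [nj|nj] := ltnP n j.+1.*2.
  by rewrite -iterS lap0// !scaler0 addr0.
rewrite -iterS -scalerDl /bump add1n [X in _ + _ * X]/eigpoly_coef big_ord_recr /=.
rewrite -/(eigpoly_coef n j).
set e : R := 2 * j.+1%:R * _.
suff e0 : e != 0 by rewrite mulrCA mulrN mulfV// mulrN1 subrr scale0r.
rewrite /e !mulf_neq0 ?pnatr_eq0//.
have -> : 2 * n%:R - 2 * j.+1%:R + d%:R - 2 = (2 * n + d - j.+1.*2 - 2)%:R :> R.
  rewrite !natrB; [|lia|lia]; rewrite natrD natrM -[j.+1.*2]mul2n natrM; ring.
by rewrite pnatr_eq0; lia.
Qed.

Lemma msize_eigpolyB m : (msize (eigpoly m - mpolyX R m) <= mdeg m)%N.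
Proof.
rewrite /eigpoly big_ord_recl /= /eigpoly_coef big_ord0 scale1r addrC addrA addNr add0r.
apply: leq_trans (msize_sum _ _ _) _; apply/bigmax_leqP => j _.
apply: leq_trans (msizeZ_le _ _) _; rewrite -iterS.
by apply: leq_trans (msize_lap _ _) _; rewrite doubleS subSS leq_subr.
Qed.

Lemma mcoeff_eigpoly m k : (mdeg m <= mdeg k)%N -> (eigpoly m)@_k = (m == k)%:R.
Proof.
move=> mk; rewrite -(subrK (mpolyX R m) (eigpoly m)) mcoeffD mcoeffX.
by rewrite (proj1 (msize_leP _ (mdeg m)) (msize_eigpolyB m))// add0r.
Qed.

Lemma eigpoly_neq0 m : eigpoly m != 0.
Proof.
apply/eqP => m0; have := mcoeff_eigpoly (leqnn (mdeg m)).
by rewrite m0 mcoeff0 eqxx => /esym/eqP; rewrite oner_eq0.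
Qed.

(** Triangularity: in a vanishing combination, look at a member of maximal
    degree and at the coefficient of its leading monomial. *)
Lemma eigpoly_lin_indep : lin_indep (range eigpoly).
Proof.
move=> s c us sB sum0 v vs.
have [//|cv] := eqVneq (c v) 0; exfalso.
have degE m : msize (eigpoly m) = (mdeg m).+1.
  apply/eqP; rewrite eqn_leq; apply/andP; split.
    apply/msize_leP => k mk; rewrite mcoeff_eigpoly; last exact: ltnW.
    by case: eqP => // e; rewrite e ltnn in mk.
  rewrite ltnNge; apply/negP => /msize_leP/(_ m (leqnn _)).
  by move/eqP; rewrite mcoeff_eigpoly// eqxx oner_eq0.
have [u [us' cu umax]] : exists u, [/\ u \in s, c u != 0 &
    forall u', u' \in s -> c u' != 0 -> (msize u' <= msize u)%N].
  pose Q k := has (fun u => (c u != 0) && (msize u == k)) s.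
  have exQ : exists k, Q k.
    by exists (msize v); apply/hasP; exists v => //; rewrite cv eqxx.
  have ubQ k : Q k -> (k <= \max_(u <- s) msize u)%N.
    by move=> /hasP[u us' /andP[_ /eqP <-]]; exact: leq_bigmax_seq.
  have [k /hasP[u us' /andP[cu /eqP uk]] kmax] := ex_maxnP exQ ubQ.
  exists u; split => // u' u's cu'; rewrite uk; apply: kmax.
  by apply/hasP; exists u' => //; rewrite cu' eqxx.
have [m _ mu] := sB _ us'.
have := congr1 (mcoeff m) sum0; rewrite raddf_sum mcoeff0 /= (bigD1_seq u)//=.
rewrite mcoeffZ -{2}mu mcoeff_eigpoly// eqxx mulr1 big_seq_cond big1 ?addr0.
  by move/eqP; rewrite (negbTE cu).
move=> u' /andP[u's u'u]; rewrite mcoeffZ.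
have [->|cu'] := eqVneq (c u') 0; first by rewrite mul0r.
have := umax _ u's cu'; have [m' _ mu'] := sB _ u's.
rewrite -mu -mu' !degE ltnS => le; rewrite mcoeff_eigpoly//.
by case: eqP => [mm|_]; [rewrite -mu -mu' mm eqxx in u'u|rewrite mulr0].
Qed.

Lemma eigpoly_spans : spans (range eigpoly).
Proof.
pose comb p := exists l : seq (R * multinom d),
  p = \sum_(am <- l) am.1 *: eigpoly am.2.
have comb0 : comb 0 by exists [::]; rewrite big_nil.
have combD p q : comb p -> comb q -> comb (p + q).
  by move=> [l ->] [l' ->]; exists (l ++ l'); rewrite big_cat.
have combZ a p : comb p -> comb (a *: p).
  move=> [l ->]; exists [seq (a * am.1, am.2) | am <- l].
  by rewrite big_map scaler_sumr; apply: eq_bigr => am _; rewrite scalerA.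
have all_comb n p : (msize p <= n)%N -> comb p.
  elim: n p => [|n IH] p; first by rewrite leqn0 msize_poly_eq0 => /eqP ->.
  move=> pn; rewrite [p]mpolyE big_seq; elim/big_ind: _ => // m mp.
  apply: (combZ); rewrite -[mpolyX R m](subKr (eigpoly m)); apply: (combD).
    by exists [:: (1, m)]; rewrite big_seq1 scale1r.
  rewrite -scaleN1r; apply: (combZ); apply: IH.
  apply: leq_trans (msize_eigpolyB m) _.
  by rewrite -ltnS; apply: leq_trans (msize_mdeg_lt mp) pn.
move=> w; have [l ->] := all_comb _ _ (leqnn (msize w)).
exists (undup [seq eigpoly am.2 | am <- l]).
exists (fun v => \sum_(am <- l | eigpoly am.2 == v) am.1); split.
  by move=> v; rewrite mem_undup => /mapP[am _ ->]; exists am.2.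
under [RHS]eq_bigr => v _ do rewrite scaler_suml.
rewrite (exchange_big_dep xpredT)//= big_seq [RHS]big_seq; apply: eq_bigr => am aml.
rewrite (big_rem (eigpoly am.2)) ?mem_undup ?(map_f (fun am => eigpoly am.2))//= eqxx big1_seq ?addr0//.
move=> v /andP[/eqP <-]; rewrite rem_filter ?undup_uniq// mem_filter /=.
by rewrite eqxx.
Qed.

Theorem eigpoly_basis : hamel_basis (range eigpoly) /\
  (forall P, range eigpoly P -> eigenvector (Lop (-1)) P).
Proof.
split; first by split; [exact: eigpoly_lin_indep|exact: eigpoly_spans].
move=> _ [m _ <-]; split; first exact: eigpoly_neq0.
by exists (eigval d (-1) (mdeg m)); exact: eigpolyP.
Qed.

End eigenbasis.

(** * Integration along lines *)

Section boxes.
Context {R : realType}.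

Definition box d (a b : R) : set (d.-tuple R) :=
  [set x | forall i, tnth x i \in `[a, b]].
Arguments box d a b _ : clear implicits.

Lemma measurable_box d (a b : R) : measurable (box d a b).
Proof.
rewrite (_ : box d a b = \bigcap_(i in [set: 'I_d]) ((@tnth d R)^~ i @^-1` `[a, b])).
  apply: fin_bigcap_measurable => // i _; rewrite -[X in measurable X]setTI.
  exact: measurable_tnth.
by apply/seteqP; split=> x /= xab i => [_|]; have := xab i; rewrite /= ?in_itv//=; apply.
Qed.

Lemma cons_tuple_box d (a b : R) :
  (@Defs.cons_tuple R d) @^-1` box d.+1 a b = `[a, b] `*` box d a b.
Proof.
apply/seteqP; split=> [[x y] /= xy|[x y] /= [xab yab] i].
  split; first by have := xy ord0; rewrite (tnth_nth 0).
  by move=> i; have := xy (lift ord0 i); rewrite !(tnth_nth 0).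
case: (unliftP ord0 i) => [j ->|->]; last by rewrite (tnth_nth 0).
by have := yab j; rewrite !(tnth_nth 0).
Qed.

Lemma lebesgue_tuple_box d (a b : R) : a <= b ->
  lebesgue_tuple d (box d a b) = ((b - a) ^+ d)%:E.
Proof.
move=> ab; elim: d => [|d IH].
  by rewrite /= diracE mem_set// => -[].
rewrite /= /pushforward cons_tuple_box product_measure1E//; last exact: measurable_box.
rewrite [X in (_ * X)%E]IH [X in (X * _)%E]lebesgue_measure_itv/= lte_fin exprS EFinM.
by case: ltgtP ab => // -> _; rewrite subrr !mul0e.
Qed.

Lemma lebesgue_tuple_box_lty d (a b : R) : (lebesgue_tuple d (box d a b) < +oo)%E.
Proof.
apply: (@le_lt_trans _ _ (lebesgue_tuple d (box d (Num.min a b) b))); last first.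
  by rewrite lebesgue_tuple_box ?ltry// ge_min lexx orbT.
rewrite le_measure ?inE//; [exact: measurable_box|exact: measurable_box|].
move=> x xab i; have := xab i; rewrite !in_itv/= => /andP[ax ->].
by rewrite andbT ge_min ax.
Qed.

End boxes.

Arguments box {R} d a b _.

Section line_integrals.
Context {R : realType}.

Definition set_tnth d (x : d.-tuple R) (i : 'I_d) (t : R) : d.-tuple R :=
  [tuple if j == i then t else tnth x j | j < d].

Lemma set_tnth_cons0 d x (y : d.-tuple R) t :
  set_tnth (Defs.cons_tuple (x, y)) ord0 t = Defs.cons_tuple (t, y).
Proof.
apply: eq_from_tnth => i; rewrite tnth_mktuple.
case: (unliftP ord0 i) => [j ->|->]; last by rewrite eqxx !(tnth_nth 0).
by rewrite eq_sym (negbTE (neq_lift _ _)) !(tnth_nth 0).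
Qed.

Lemma set_tnth_consS d x (y : d.-tuple R) i t :
  set_tnth (Defs.cons_tuple (x, y)) (lift ord0 i) t = Defs.cons_tuple (x, set_tnth y i t).
Proof.
apply: eq_from_tnth => j; rewrite tnth_mktuple.
case: (unliftP ord0 j) => [k ->|->].
  rewrite (inj_eq lift_inj); transitivity (tnth (set_tnth y i t) k).
    by rewrite tnth_mktuple; case: eqP => // _; rewrite !(tnth_nth 0).
  by rewrite !(tnth_nth 0).
by rewrite (negbTE (neq_lift _ _)) !(tnth_nth 0).
Qed.

Lemma integrable_bounded_support dd (T : measurableType dd)
    (mu : {measure set T -> \bar R}) (D : set T) (f : T -> R) (M : R) :
  measurable D -> (mu D < +oo)%E -> measurable_fun setT f ->
  (forall x, `|f x| <= M) -> (forall x, ~ D x -> f x = 0) ->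
  mu.-integrable setT (EFin \o f).
Proof.
move=> mD Dfin mf fM f0.
have fD : mu.-integrable D (EFin \o f).
  apply: measurable_bounded_integrable => //; first exact: measurable_funTS.
  exists M; split; first exact: num_real.
  by move=> N MN x _; apply: le_trans (fM x) (ltW MN).
have := (integrable_mkcond (EFin \o f) mD).1 fD.
congr (integrable _ _ _); apply/funext => x; rewrite patchE.
case: ifPn => //; rewrite notin_setE => nDx.
by rewrite /= f0.
Qed.

Lemma measurable_cons_tuple d :
  measurable_fun [set: measurableTypeR R * d.-tuple R] (@Defs.cons_tuple R d).
Proof. exact: measurable_cons. Qed.

(** Fubini's theorem in the form that is needed: a function whose integrals
    along all lines parallel to one axis vanish has integral zero. Boundedness
    with bounded support passes to slices, which makes the induction on the
    dimension work without any discussion of exceptional slices. *)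
Lemma integral_lines_eq0 d (i : 'I_d) (f : d.-tuple R -> R) (a b M : R) :
  measurable_fun setT f -> (forall x, `|f x| <= M) ->
  (forall x, ~ box d a b x -> f x = 0) ->
  (forall x, (\int[lebesgue_measure]_t (f (set_tnth x i t))%:E = 0)%E) ->
  (\int[lebesgue_tuple d]_x (f x)%:E = 0)%E.
Proof.
elim: d i f => [[] //|d IH] i f mf fM f0 line.
pose mu := (@lebesgue_measure R \x @lebesgue_tuple R d)%E.
pose g := f \o @Defs.cons_tuple R d.
have mg : measurable_fun setT g by apply: measurableT_comp => //; exact: measurable_cons_tuple.
have ig : mu.-integrable setT (EFin \o g).
  apply: (@integrable_bounded_support _ _ mu (`[a, b] `*` box d a b) g M) => //.
  - apply: measurableX => //; exact: measurable_box.
  - apply: (@le_lt_trans _ _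
        (lebesgue_measure `[a, b]%classic * lebesgue_tuple d (box d a b))%E).
      rewrite le_eqVlt; apply/orP; left; apply/eqP.
      by apply: product_measure1E => //; exact: measurable_box.
    apply: lte_mul_pinfty => //; last exact: lebesgue_tuple_box_lty.
    by rewrite ge0_fin_numE//= lebesgue_measure_itv/=; case: ifP => _; rewrite ?ltry.
  - by move=> z; exact: fM.
  - by move=> z nz; apply: f0; apply: contra_not nz; rewrite -cons_tuple_box.
have mf' : measurable_fun setT (EFin \o f) by exact/measurable_EFinP.
have E := @integral_pushforward _ _ _ _ _ _ (@measurable_cons_tuple d) mu setT
  (EFin \o f) mf' ig measurableT.
apply: eq_trans (eq_trans _ E) _.
  by apply: eq_measure_integral => [|mc A mA _ //]; exact: measurable_cons_tuple.
rewrite preimage_setT.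
case: (unliftP ord0 i) => [j ij|i0].
  rewrite -[LHS]/(\int[mu]_z (EFin \o g) z)%E -integral12_prod_meas1//.
  apply: integral0_eq => x _.
  apply: (IH j (fun y => g (x, y))) => //.
  - apply: (measurableT_comp mf).
    by apply: (@measurable_cons _ _ _ _ (cst (x : R)) _ id).
  - by move=> y; exact: (fM (Defs.cons_tuple (x, y))).
  - move=> y ny; apply: f0 => xy; apply: ny.
    by have [] : (`[a, b] `*` box d a b) (x, y) by rewrite -cons_tuple_box.
  - move=> y; rewrite -[RHS](line (Defs.cons_tuple (x, y))).
    by apply: eq_integral => t _; rewrite ij set_tnth_consS.
rewrite -[LHS]/(\int[mu]_z (EFin \o g) z)%E -integral21_prod_meas1//.
apply: integral0_eq => y _; rewrite -[RHS](line (Defs.cons_tuple (0, y))).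
by apply: eq_integral => t _; rewrite i0 set_tnth_cons0.
Qed.

End line_integrals.

(** * Polynomial integrals over the ball *)

Section polynomial_integrals.
Context {R : realType} {d : nat}.
Implicit Types (p q h : {mpoly R[d]}) (x : d.-tuple R).

Lemma measurable_meval p : measurable_fun setT (fun x : d.-tuple R => meval (tnth x) p).
Proof.
elim/mpolyind: p => [|c m p _ _ IH].
  by under eq_fun do rewrite meval0; exact: measurable_cst.
under eq_fun do rewrite mevalD mevalZ mevalX.
apply: measurable_funD => //; apply: measurable_funM => //.
by apply: measurable_prod => i _; apply: measurable_funX; exact: measurable_tnth.
Qed.

Lemma meval_bounded p :
  exists M : R, forall x, box d (-1) 1 x -> `|meval (tnth x) p| <= M.
Proof.
elim/mpolyind: p => [|c m p _ _ [M IH]]; first by exists 0 => x _; rewrite meval0 normr0.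
exists (`|c| + M) => x xb; rewrite mevalD mevalZ mevalX.
apply: le_trans (ler_normD _ _) _; rewrite lerD ?IH// normrM ler_piMr// normr_prod.
apply: prodr_ile1 => i; rewrite normr_ge0 normrX exprn_ile1//=.
by have := xb i; rewrite in_itv/= -ler_norml.
Qed.

Definition polyint (mu : {measure set (d.-tuple R) -> \bar R}) D p : R :=
  \int[mu]_(x in D) meval (tnth x) p.

Section finite_mass.
Variables (mu : {measure set (d.-tuple R) -> \bar R}) (D : set (d.-tuple R)).
Hypotheses (mD : measurable D) (D_fin : (mu D < +oo)%E).
Hypothesis (D_box : D `<=` box d (-1) 1).

Lemma integrable_meval p : mu.-integrable D (EFin \o (fun x => meval (tnth x) p)).
Proof.
apply: measurable_bounded_integrable => //.
  by apply: measurable_funTS; exact: measurable_meval.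
have [M pM] := meval_bounded p; exists M; split; first exact: num_real.
by move=> N MN x /D_box/pM/le_trans; apply; exact: ltW.
Qed.

Lemma polyint_linear : linear_for *%R (polyint mu D).
Proof.
move=> c p q; rewrite /polyint.
under eq_Rintegral do rewrite mevalD mevalZ.
rewrite RintegralD//; first by rewrite RintegralZl//; exact: integrable_meval.
  have := integrable_meval (c *: p).
  by congr (integrable _ _ _); apply/funext => x /=; rewrite mevalZ.
exact: integrable_meval.
Qed.

End finite_mass.

Lemma polyint_sqr_ge0 mu D p : 0 <= polyint mu D (p * p).
Proof. by apply: Rintegral_ge0 => x _; rewrite mevalM -expr2 sqr_ge0. Qed.

Lemma polyint1 mu D : measurable D -> polyint mu D 1 = fine (mu D).
Proof.
move=> mD; rewrite /polyint; under eq_Rintegral do rewrite meval1.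
by rewrite Rintegral_cst// mul1r.
Qed.

End polynomial_integrals.

Section ball_integral.
Context {R : realType} {d : nat}.
Implicit Types (p q h : {mpoly R[d]}) (x : d.-tuple R) (i : 'I_d).

Local Notation rho := (@sqnorm R d).

Lemma meval_rho x : meval (tnth x) rho = \sum_(i < d) tnth x i ^+ 2.
Proof.
rewrite /sqnorm raddf_sum; apply: eq_bigr => i _.
by rewrite /= mevalM mevalXU expr2.
Qed.

Lemma meval_rho_ge0 x : 0 <= meval (tnth x) rho.
Proof. by rewrite meval_rho sumr_ge0// => i _; rewrite sqr_ge0. Qed.

Lemma enormE x : enorm x = Num.sqrt (meval (tnth x) rho).
Proof. by rewrite meval_rho. Qed.

Lemma sqrtr_le1 (a : R) : (Num.sqrt a <= 1) = (a <= 1).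
Proof. by rewrite -{1}sqrtr1 ler_sqrt. Qed.

Lemma eballE x : eball R d x <-> meval (tnth x) rho <= 1.
Proof. by rewrite /eball /= enormE sqrtr_le1. Qed.

Lemma eball_box : eball R d `<=` box d (-1) 1.
Proof.
move=> x /eballE; rewrite meval_rho => x1 i; rewrite in_itv/= -ler_norml.
rewrite -(@expr_le1 _ 2)// real_normK ?num_real//; apply: le_trans x1.
by rewrite (bigD1 i)//= lerDl sumr_ge0// => j _; rewrite sqr_ge0.
Qed.

Lemma measurable_eball : measurable (eball R d).
Proof.
rewrite (_ : eball R d = (fun x => meval (tnth x) rho) @^-1` `]-oo, 1]).
  by rewrite -[X in measurable X]setTI; apply: measurable_meval.
by apply/seteqP; split=> x /=; rewrite in_itv/=; move/eballE.
Qed.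

Lemma lebesgue_eball_lty : (lebesgue_tuple d (eball R d) < +oo)%E.
Proof.
apply: le_lt_trans (lebesgue_tuple_box_lty d (-1) 1).
by apply: le_measure; rewrite ?inE;
  [exact: measurable_eball|exact: measurable_box|exact: eball_box].
Qed.

(** The restriction of [p] to the line through [x] parallel to the [i]-th
    axis, as a univariate polynomial. *)
Definition line_poly x i p : {poly R} :=
  mmap polyC (fun j => if j == i then 'X else (tnth x j)%:P) p.

Lemma horner_line_poly x i p t :
  (line_poly x i p).[t] = meval (tnth (set_tnth x i t)) p.
Proof.
elim/mpolyind: p => [|c m p _ _ IH].
  by rewrite /line_poly mmap0 meval0 horner0.
move: IH; rewrite /line_poly mmapD mmapZ mmapX mevalD mevalZ mevalX hornerD => ->.
rewrite hornerM hornerC horner_prod; congr (_ * _ + _).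
apply: eq_bigr => j _; rewrite tnth_mktuple horner_exp; congr (_ ^+ _).
by case: eqP => _; rewrite ?hornerX ?hornerC.
Qed.

Lemma deriv_line_poly x i p : (line_poly x i p)^`() = line_poly x i (mderiv i p).
Proof.
pose good q := (line_poly x i q)^`() = line_poly x i (mderiv i q).
have goodM q h : good q -> good h -> good (q * h).
  rewrite /good /line_poly mderivM mmapD !rmorphM /= derivM => -> ->.
  by rewrite addrC.
have good1 : good 1.
  by rewrite /good /line_poly -[1]/(mpolyC d 1) mderivC mmapC mmap0 derivC.
have goodX j : good (mpolyX R (mnm1 j)).
  rewrite /good /line_poly mderivXU mmapX mmap1U eq_sym.
  by case: eqP => _; rewrite ?derivX ?derivC ?rmorph1 ?rmorph0.
elim/mpolyind: p => [|c m p _ _ IH].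
  by rewrite /line_poly mderiv0 mmap0 deriv0.
have gX : good (mpolyX R m).
  rewrite mpolyXE_id; elim/big_rec: _ => // j q _ gq; apply: (goodM) => //.
  by elim: (m j) => [|n IHn]; rewrite ?expr0// exprS; apply: (goodM).
rewrite linearP /= /line_poly !mmapD !mmapZ derivD derivM derivC mul0r add0r.
by rewrite [in LHS]gX; congr (_ + _); exact: IH.
Qed.

Lemma integral_deriv_horner (p : {poly R}) (r : R) : p.[r] = 0 -> p.[- r] = 0 ->
  0 <= r -> (\int[lebesgue_measure]_(t in `[(- r)%R, r]%classic) (p^`().[t])%:E = 0)%E.
Proof.
move=> pr pNr; rewrite le_eqVlt => /predU1P[<-|r0].
  by rewrite oppr0 set_itv1 integral_set1.
rewrite (@continuous_FTC2 _ (horner p^`()) (horner p)) ?pr ?pNr ?subee//.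
- by rewrite gtrN.
- by apply: continuous_subspaceT; exact: continuous_horner.
- split; first by move=> t _; exact: derivable_horner.
    by apply: cvg_at_right_filter; exact: continuous_horner.
  by apply: cvg_at_left_filter; exact: continuous_horner.
- by move=> t _; rewrite derivE.
Qed.

(** A line parallel to the [i]-th axis meets the ball in a symmetric interval
    [[- r, r]], possibly empty, at both ends of which [1 - rho] vanishes. *)
Lemma ball_integral_div i h :
  polyint (lebesgue_tuple d) (eball R d) (mderiv i ((1 - rho) * h)) = 0.
Proof.
set q := mderiv i _.
rewrite /polyint Rintegral_mkcond /Rintegral.
set f := _ \_ _.
have [M qM] := meval_bounded q.
have f_out x : ~ eball R d x -> f x = 0.
  by move=> nx; rewrite /f patchE memNset.
have f_in x : eball R d x -> f x = meval (tnth x) q.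
  by move=> ex; rewrite /f patchE mem_set.
rewrite (@integral_lines_eq0 _ _ i f (-1) 1 `|M|)//.
- apply: (proj1 (measurable_restrictT _ measurable_eball)).
  by apply: measurable_funTS; exact: measurable_meval.
- move=> x; have [xb|nxb] := pselect (eball R d x); last by rewrite f_out ?normr0.
  by rewrite f_in//; apply: le_trans (qM _ (eball_box xb)) (ler_norm _).
- by move=> x nx; apply: f_out => /eball_box.
move=> x.
pose c := 1 - \sum_(j < d | j != i) tnth x j ^+ 2.
have rhoE t : meval (tnth (set_tnth x i t)) rho = t ^+ 2 + (1 - c).
  rewrite meval_rho (bigD1 i)//= tnth_mktuple eqxx /c.
  under eq_bigr => j ji do rewrite tnth_mktuple (negbTE ji).
  by ring.
have ballP t : eball R d (set_tnth x i t) <-> t ^+ 2 <= c.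
  rewrite eballE rhoE; split; lra.
(* When [c < 0] the line misses the ball. *)
have [c0|c0] := ltP c 0.
  apply: integral0_eq => t _; rewrite f_out// ballP => tc.
  by have := sqr_ge0 t; rewrite leNgt (le_lt_trans tc c0).
pose r := Num.sqrt c.
have r0 : 0 <= r by exact: sqrtr_ge0.
have r2 : r ^+ 2 = c by rewrite sqr_sqrtr.
pose P := line_poly x i ((1 - rho) * h).
have P0 t : t ^+ 2 = c -> P.[t] = 0.
  by move=> tc; rewrite horner_line_poly mevalM mevalB meval1 rhoE tc; ring.
rewrite -[RHS](@integral_deriv_horner P r _ _ r0) ?P0 ?sqrrN//.
rewrite [RHS]integral_mkcond; apply: eq_integral => t _.
rewrite patchE; case: ifPn => [|].
  rewrite inE/= in_itv/= -ler_norml => tr; rewrite deriv_line_poly horner_line_poly f_in//.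
  by rewrite ballP -r2 -[t ^+ 2]real_normK ?num_real// lerXn2r ?nnegrE.
rewrite notin_setE/= in_itv/= -ler_norml => tr; rewrite f_out//.
rewrite ballP -r2 -[t ^+ 2]real_normK ?num_real// => trr; apply: tr.
by rewrite -(@ler_pXn2r _ 2)// ?nnegrE.
Qed.

End ball_integral.

(** * Polynomial integrals over the sphere *)

Section sphere_integral.
Context {R : realType} {d : nat}.
Implicit Types (p q h : {mpoly R[d]}) (x : d.-tuple R) (i j : 'I_d).

Local Notation rho := (@sqnorm R d).

Definition punctured_ball : set (d.-tuple R) := [set x | 0 < enorm x <= 1].

(** Sending the complement of the punctured ball to the origin makes the
    preimage of any subset of the sphere equal to the cone over it, so that the
    surface measure becomes [d] times an image of Lebesgue measure. *)
Definition punctured_radial_proj x : d.-tuple R :=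
  if 0 < enorm x <= 1 then radial_proj x else [tuple 0 | _ < d].

Lemma punctured_ball_eball : punctured_ball `<=` eball R d.
Proof. by move=> x /andP[]. Qed.

Lemma measurable_punctured_ball : measurable punctured_ball.
Proof.
rewrite (_ : punctured_ball = (fun x => meval (tnth x) rho) @^-1` `]0, 1]).
  by rewrite -[X in measurable X]setTI; apply: measurable_meval.
by apply/seteqP; split=> x; rewrite /punctured_ball /= in_itv/= enormE sqrtr_gt0 sqrtr_le1.
Qed.

Lemma lebesgue_punctured_ball_lty :
  (lebesgue_tuple d punctured_ball < +oo)%E.
Proof.
apply: le_lt_trans lebesgue_eball_lty.
by apply: le_measure; rewrite ?inE;
  [exact: measurable_punctured_ball|exact: measurable_eball|exact: punctured_ball_eball].
Qed.

Lemma measurable_punctured_radial_proj : measurable_fun setT punctured_radial_proj.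
Proof.
apply/measurable_fun_tnthP => i.
rewrite (_ : _ \o _ = (fun x => tnth x i * meval (tnth x) rho `^ (- 2^-1)) \_ punctured_ball).
  apply: (proj1 (measurable_restrictT _ measurable_punctured_ball)).
  apply: measurable_funTS; apply: measurable_funM; first exact: measurable_tnth.
  exact: (measurableT_comp (measurable_powR _) (measurable_meval _)).
apply/funext => x; rewrite /= patchE /punctured_radial_proj.
case: ifPn => xD.
  by rewrite mem_set// tnth_mktuple enormE powRN powR12_sqrt// meval_rho_ge0.
by rewrite memNset ?tnth_mktuple//; exact/negP.
Qed.

Lemma enorm_radial_proj x : 0 < enorm x -> enorm (radial_proj x) = 1.
Proof.
move=> x0; rewrite {1}/enorm.
under eq_bigr do rewrite tnth_mktuple expr_div_n.
rewrite -mulr_suml -meval_rho.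
have -> : enorm x ^+ 2 = meval (tnth x) rho by rewrite enormE sqr_sqrtr// meval_rho_ge0.
rewrite divff ?sqrtr1//.
by move: x0; rewrite enormE sqrtr_gt0 => /gt_eqF ->.
Qed.

Lemma preimage_punctured_radial_proj (A : set (d.-tuple R)) : A `<=` esphere R d ->
  punctured_radial_proj @^-1` A = cone A.
Proof.
move=> AS; apply/seteqP; split=> x; rewrite /cone/= /punctured_radial_proj.
  case: ifPn => // _ /AS; rewrite /esphere /= /enorm.
  rewrite big1 ?sqrtr0 => [/esym/eqP|i _]; first by rewrite oner_eq0.
  by rewrite tnth_mktuple expr0n.
by move=> [-> ].
Qed.

Lemma cone_esphere : cone (esphere R d) = punctured_ball.
Proof.
apply/seteqP; split=> x; first by case.
by move=> xD; split=> //; apply: enorm_radial_proj; case/andP: xD.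
Qed.

Lemma measurable_esphere : measurable (esphere R d).
Proof.
rewrite (_ : esphere R d = (fun x => meval (tnth x) rho) @^-1` [set 1]).
  by rewrite -[X in measurable X]setTI; apply: measurable_meval.
apply/seteqP; split=> x; rewrite /esphere /= enormE.
  by move=> x1; rewrite -[LHS]sqr_sqrtr ?meval_rho_ge0// x1 expr1n.
by move=> ->; rewrite sqrtr1.
Qed.

Lemma esphere_box : esphere R d `<=` box d (-1) 1.
Proof. by move=> x x1; apply: eball_box; rewrite /eball /= x1. Qed.

Lemma surface_esphere :
  surface_measure R d (esphere R d) = (d%:R%:E * lebesgue_tuple d punctured_ball)%E.
Proof. by rewrite /surface_measure cone_esphere. Qed.

Lemma surface_esphere_lty : (surface_measure R d (esphere R d) < +oo)%E.
Proof.
rewrite surface_esphere lte_mul_pinfty ?lee_fin// lebesgue_punctured_ball_lty//.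
Qed.

Lemma ge0_surface_integral (f : d.-tuple R -> \bar R) :
  measurable_fun setT f -> (forall x, 0 <= f x)%E ->
  (\int[surface_measure R d]_(x in esphere R d) f x =
   d%:R%:E * \int[lebesgue_tuple d]_(x in punctured_ball) f (punctured_radial_proj x))%E.
Proof.
move=> mf f0.
have mS := measurable_esphere.
have mP := measurable_punctured_radial_proj.
pose k : {nonneg R} := NngNum (ler0n R d).
pose nu := pushforward (@lebesgue_tuple R d) punctured_radial_proj.
have nuE A : A `<=` esphere R d ->
    surface_measure R d A = (d%:R%:E * nu A)%E.
  by move=> AS; rewrite /nu /pushforward preimage_punctured_radial_proj.
have := @ge0_integral_pushforward _ _ _ _ _ _ mP (@lebesgue_tuple R d)
  (esphere R d) f mS (measurable_funTS mf) (fun x _ => f0 x).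
rewrite preimage_punctured_radial_proj// cone_esphere => <-.
rewrite -[d%:R]/(k%:num) -(@ge0_integral_mscale _ _ _ _ _ mS k f (measurable_funTS mf))//.
apply: eq_measure_integral => A mA AS.
exact: nuE.
Qed.

Lemma measurable_radial_meval p :
  measurable_fun setT (fun x => meval (tnth (punctured_radial_proj x)) p).
Proof. exact: (measurableT_comp (measurable_meval p) measurable_punctured_radial_proj). Qed.

Lemma punctured_radial_proj_box x : box d (-1) 1 (punctured_radial_proj x).
Proof.
rewrite /punctured_radial_proj; case: ifPn => [/andP[x0 _]|_].
  by apply: esphere_box; exact: enorm_radial_proj.
by move=> i; rewrite tnth_mktuple in_itv/= lerN10 ler01.
Qed.

Lemma integrable_radial_meval p : (lebesgue_tuple d).-integrable punctured_ball
  (EFin \o fun x => meval (tnth (punctured_radial_proj x)) p).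
Proof.
apply: measurable_bounded_integrable.
- exact: measurable_punctured_ball.
- exact: lebesgue_punctured_ball_lty.
- by apply: measurable_funTS; exact: measurable_radial_meval.
have [M pM] := meval_bounded p; exists M; split; first exact: num_real.
move=> N MN x _; apply: le_trans (pM _ (punctured_radial_proj_box x)) _.
exact: ltW.
Qed.

Lemma surface_polyint p :
  polyint (surface_measure R d) (esphere R d) p =
  d%:R * \int[lebesgue_tuple d]_(x in punctured_ball)
           meval (tnth (punctured_radial_proj x)) p.
Proof.
have mp : measurable_fun setT (EFin \o fun x : d.-tuple R => meval (tnth x) p).
  by apply/measurable_EFinP; exact: measurable_meval.
rewrite /polyint /Rintegral integralE !ge0_surface_integral//; last 2 first.
  exact: measurable_funeneg.
  exact: measurable_funepos.
rewrite [in RHS]integralE.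
have mD := measurable_punctured_ball.
have ig := integrable_radial_meval p.
have fp := integrable_fin_num mD (integrable_funepos mD ig).
have fn := integrable_fin_num mD (integrable_funeneg mD ig).
suff H (k : R) (a b : \bar R) : a \is a fin_num -> b \is a fin_num ->
    fine (k%:E * a - k%:E * b)%E = k * fine (a - b)%E. 
  rewrite -[RHS](H _ _ _ fp fn); congr (fine (_ * _ - _ * _)%E);
    by apply: eq_integral => x _; rewrite !(funeposE, funenegE).
by case: a b => [a| |] [b| |] //= _ _; rewrite mulrBr.
Qed.

Lemma meval_mpolyX_scale (c : R) (v : 'I_d -> R) (m : multinom d) :
  meval (fun i => c * v i) (mpolyX R m) = c ^+ mdeg m * meval v (mpolyX R m).
Proof.
rewrite !mevalX mdegE -prodrXr -big_split.
by apply: eq_bigr => i _; rewrite exprMn.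
Qed.

Lemma meval_drot_scale (c : R) (v : 'I_d -> R) (m : multinom d) i j :
  meval (fun i => c * v i) (drot i j (mpolyX R m)) =
  c ^+ mdeg m * meval v (drot i j (mpolyX R m)).
Proof.
have H k l : meval (fun i => c * v i) (mpolyX R (mnm1 k) * mderiv l (mpolyX R m)) =
    c ^+ mdeg m * meval v (mpolyX R (mnm1 k) * mderiv l (mpolyX R m)).
  rewrite mderivX -scalerAr -mpolyXD !mevalZ.
  have [->|ml] := posnP (m l); first by rewrite !mul0r mulr0.
  rewrite meval_mpolyX_scale mulrCA; congr (_ ^+ _ * _).
  rewrite mdegD mdeg1 addnC -(mdeg1 l) -mdegD; congr mdeg.
  apply/mnmP => a; rewrite mnmDE mnmBE mnm1E subnK//.
  by case: eqP => // <-.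
by rewrite /drot !mevalB !H mulrBr.
Qed.

(** Polynomials in [rho] that increase to [rho ^- (1 / 2)] on the punctured
    ball. With [z = |x| * invsqrt_rho n], the iteration reads
    [1 - z' = (1 - z) * (1 - |x| * (1 + z) / 2)]. *)
Fixpoint invsqrt_rho n : {mpoly R[d]} :=
  if n is n'.+1 then
    invsqrt_rho n' + 2^-1 *: (1 - rho * invsqrt_rho n' ^+ 2)
  else 0.

Lemma drot_invsqrt_rho i j n : drot i j (invsqrt_rho n) = 0.
Proof.
elim: n => [|n IH] /=; first by rewrite raddf0.
have E : drot i j (1 - rho * invsqrt_rho n ^+ 2) = 0.
  rewrite linearB /= expr2 !drot_derivation IH drot_rho.
  by rewrite /drot -[1]/(mpolyC d 1) !mderivC !(mulr0, mul0r, addr0, subr0).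
have EZ : drot i j (2^-1 *: (1 - rho * invsqrt_rho n ^+ 2)) = 2^-1 *: 0 by rewrite -E; exact: linearZ.
by rewrite linearD /= IH add0r EZ scaler0.
Qed.

Lemma invsqrt_rho_bounds x n : 0 < enorm x <= 1 ->
  1 - (1 - enorm x / 2) ^+ n <= enorm x * meval (tnth x) (invsqrt_rho n) <= 1.
Proof.
move=> /andP[r0 r1]; set r := enorm x in r0 r1 *.
have r2 : meval (tnth x) rho = r ^+ 2 by rewrite /r enormE sqr_sqrtr// meval_rho_ge0.
suff : 0 <= r * meval (tnth x) (invsqrt_rho n) /\
    0 <= 1 - r * meval (tnth x) (invsqrt_rho n) <= (1 - r / 2) ^+ n.
  by move=> [_ /andP[z1 z2]]; apply/andP; split; lra.
elim: n => [|n]; first by rewrite meval0 mulr0 expr0; split => //; lra.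
rewrite /= mevalD mevalZ mevalB mevalM meval1 rmorphXn /= r2.
set y := meval _ _; rewrite -/y.
have -> : r * (y + 2^-1 * (1 - r ^+ 2 * y ^+ 2)) =
  r * y + r * (1 - (r * y) ^+ 2) / 2 by field.
set z := r * y => -[z0 /andP[z1 zn]].
have -> : 1 - (z + r * (1 - z ^+ 2) / 2) = (1 - z) * (1 - r * (1 + z) / 2) by field.
have z2 : 0 <= 1 - z ^+ 2 by rewrite (_ : _ - _ = (1 - z) * (1 + z)); [rewrite mulr_ge0//; lra|ring].
have rz : 0 <= r * z by rewrite mulr_ge0// ltW.
have rz1 : r * z <= 1 by rewrite mulr_ile1//; lra.
split; first by rewrite addr_ge0// divr_ge0// mulr_ge0// ltW.
apply/andP; split; first by rewrite mulr_ge0//; lra.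
rewrite exprSr ler_pM//; lra.
Qed.

(** For [h] a monomial of degree [k], the polynomial [q = drot i j h] is
    homogeneous of degree [k], so that [q (x / |x|)] is the limit of
    [invsqrt_rho n ^+ k * q], with a bound independent of [n]. These products
    are again in the image of [drot i j], which does not see functions of
    [rho], and their integrals over the ball vanish. *)
Lemma sphere_drot i j h :
  polyint (surface_measure R d) (esphere R d) (drot i j h) = 0.
Proof.
have lin := polyint_linear measurable_esphere surface_esphere_lty esphere_box.
elim/mpolyind: h => [|c m h _ _ IH].
  rewrite raddf0 surface_polyint.
  under eq_Rintegral do rewrite meval0.
  by rewrite Rintegral_cst ?mul0r ?mulr0//; exact: measurable_punctured_ball.
rewrite linearP /= lin IH addr0; apply/eqP; rewrite mulf_eq0; apply/orP; right; apply/eqP.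
rewrite surface_polyint.
set q := drot i j _; pose k := mdeg m.
pose p n := invsqrt_rho n ^+ k * q.
have pE n : p n = drot i j (invsqrt_rho n ^+ k * mpolyX R m).
  rewrite drot_derivation (derivation_exp _ _ (@drot_derivation _ _ i j)).
  by rewrite drot_invsqrt_rho mulr0 mul0r add0r.
have mD := measurable_punctured_ball.
have p0 n : (\int[lebesgue_tuple d]_(x in punctured_ball) (meval (tnth x) (p n))%:E = 0)%E.
  have ballE := setIidr punctured_ball_eball.
  rewrite -ballE integral_mkcondr.
  transitivity (\int[lebesgue_tuple d]_(x in eball R d) (meval (tnth x) (p n))%:E)%E.
    apply: eq_integral => x; rewrite inE => xB; rewrite patchE; case: ifPn => //.
    (* The origin is the only point to be added, and [drot] vanishes there. *)
    rewrite notin_setE /punctured_ball /= => nx.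
    have x0 : enorm x = 0.
      apply/eqP; rewrite eq_le -[enorm x <= 0]negbK -ltNge; apply/andP; split.
        by apply/negP => x0; apply: nx; rewrite x0.
      by rewrite enormE sqrtr_ge0.
    have xi l : tnth x l = 0.
      move/eqP: x0; rewrite /enorm sqrtr_eq0 => x0; apply/eqP; rewrite -sqrf_eq0.
      rewrite eq_le sqr_ge0 andbT; apply: le_trans x0.
      by rewrite (bigD1 l)//= lerDl sumr_ge0// => a _; rewrite sqr_ge0.
    by rewrite /p /q mevalM mevalB !mevalM !mevalXU !xi !mul0r subrr mulr0.
  have iB := integrable_meval measurable_eball lebesgue_eball_lty (@eball_box R d) (p n).
  rewrite -[LHS]fineK ?(integrable_fin_num measurable_eball iB)//; congr (_%:E).
  rewrite -[LHS]/(polyint _ _ _) pE.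
  pose lB := polyint_linear measurable_eball lebesgue_eball_lty (@eball_box R d).
  pose B : {linear {mpoly R[d]} -> R | *%R} := HB.pack (polyint (lebesgue_tuple d) (eball R d))
    (GRing.isLinear.Build _ _ _ _ _ lB).
  by apply: (@ball_drot _ _ B) => [a u|u]; [exact: ball_integral_div|exact: polyint_sqr_ge0].
pose f x := meval (tnth (punctured_radial_proj x)) q.
have fE n x : punctured_ball x ->
    meval (tnth x) (p n) = (enorm x * meval (tnth x) (invsqrt_rho n)) ^+ k * f x.
  move=> xD; rewrite /p mevalM rmorphXn exprMn -mulrA mulrCA; congr (_ * _).
  rewrite -meval_drot_scale; apply: meval_eq => l.
  rewrite /punctured_radial_proj xD tnth_mktuple mulrC divfK//.
  by case/andP: xD => /gt_eqF ->.
have [M fM] := meval_bounded q.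
have mp n : measurable_fun punctured_ball (fun x => (meval (tnth x) (p n))%:E).
  by apply/measurable_EFinP; apply: measurable_funTS; exact: measurable_meval.
have mf : measurable_fun punctured_ball (EFin \o f).
  by apply/measurable_EFinP; apply: measurable_funTS; exact: measurable_radial_meval.
have pf x : punctured_ball x ->
    (fun n => (meval (tnth x) (p n))%:E) @ \oo --> (f x)%:E.
  move=> xD; apply: cvg_EFin; first by near=> n.
  rewrite (_ : _ \o _ = fun n => (enorm x * meval (tnth x) (invsqrt_rho n)) ^+ k * f x).
    rewrite -[f x in X in _ --> X]mul1r -(expr1n _ k).
    apply: cvgM; last exact: cvg_cst.
    apply: (continuous_cvg _ (@exprn_continuous _ _ _)).
    have b n := invsqrt_rho_bounds n xD.
    apply: (@squeeze_cvgr _ _ _ _ (fun n => 1 - (1 - enorm x / 2) ^+ n) (cst 1)).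
    + by near=> n; exact: b.
    + rewrite -[X in _ --> X]subr0; apply: cvgB; first exact: cvg_cst.
      by apply: cvg_expr; case/andP: xD => ? ?; rewrite ger0_norm; lra.
    + exact: cvg_cst.
  by apply/funext => n /=; rewrite fE.
have iM : (lebesgue_tuple d).-integrable punctured_ball (EFin \o cst M).
  apply: measurable_bounded_integrable => //; first exact: lebesgue_punctured_ball_lty.
  by exists `|M|; split; [exact: num_real|move=> N MN x _; exact: ltW].
have pM x n : punctured_ball x -> (`|(meval (tnth x) (p n))%:E| <= M%:E)%E.
  move=> xD; rewrite fE// /= lee_fin normrM.
  have /andP[z1 z2] := invsqrt_rho_bounds n xD.
  rewrite -[M]mul1r ler_pM//; last exact/fM/punctured_radial_proj_box.
  have /andP[r0 r1] := xD.
  have rn : (1 - enorm x / 2) ^+ n <= 1 by rewrite exprn_ile1//; lra.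
  by rewrite normrX exprn_ile1// ger0_norm//; lra.
have [_ _ cvg0] := dominated_convergence mD mp mf (aeW _ pf) iM (aeW _ pM).
rewrite /Rintegral.
suff -> : (\int[lebesgue_tuple d]_(x in punctured_ball) (f x)%:E = 0)%E by rewrite mulr0.
apply: (@cvg_unique _ (@ereal_hausdorff R) _ _ _ _ cvg0).
rewrite (_ : [sequence _]_n = cst 0%E); first exact: cvg_cst.
by apply/funext => n; exact: p0.
Unshelve. all: by end_near.
Qed.

End sphere_integral.

(** * Positivity of the masses and the theorem *)

Section total_mass.
Context {R : realType} {d : nat}.
Hypothesis d_gt0 : (0 < d)%N.

Local Notation rho := (@sqnorm R d).

(** A cube of side [1 / (2 d)] away from the origin is contained in the
    punctured ball. *)
Lemma lebesgue_punctured_ball_gt0 :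
  (0 < lebesgue_tuple d (punctured_ball : set (d.-tuple R)))%E.
Proof.
have dR : 0 < d%:R :> R by rewrite ltr0n.
have d1 : 1 <= d%:R :> R by rewrite ler1n.
set b : R := d%:R^-1.
have b0 : 0 < b by rewrite invr_gt0.
have b1 : b <= 1 by rewrite invf_le1.
apply: (@lt_le_trans _ _ (lebesgue_tuple d (box d (b / 2) b))).
  by rewrite lebesgue_tuple_box ?lte_fin ?exprn_gt0//; lra.
apply: le_measure; rewrite ?inE;
  [exact: measurable_box|exact: measurable_punctured_ball|].
move=> x xb.
have xi i : b / 2 <= tnth x i <= b by have := xb i; rewrite in_itv.
rewrite /punctured_ball /= enormE sqrtr_gt0 sqrtr_le1 meval_rho; apply/andP; split.
  rewrite (bigD1 (Ordinal d_gt0))//= ltr_wpDr ?sumr_ge0// => [i _|].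
    by rewrite sqr_ge0.
  by rewrite exprn_gt0//; have := xi (Ordinal d_gt0); lra.
apply: (@le_trans _ _ (\sum_(i < d) b)).
  apply: ler_sum => i _; have /andP[x1 x2] := xi i.
  rewrite expr2 -[leRHS]mulr1 ler_pM//; lra.
by rewrite sumr_const card_ord -mulr_natl mulfV// gt_eqF.
Qed.

Lemma ball_mass_gt0 : 0 < polyint (lebesgue_tuple d) (eball R d) 1.
Proof.
rewrite polyint1; last exact: measurable_eball.
rewrite fine_gt0// lebesgue_eball_lty andbT.
apply: lt_le_trans lebesgue_punctured_ball_gt0 _.
by apply: le_measure; rewrite ?inE;
  [exact: measurable_punctured_ball|exact: measurable_eball|exact: punctured_ball_eball].
Qed.

Lemma sphere_mass_gt0 : 0 < polyint (surface_measure R d) (esphere R d) 1.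
Proof.
rewrite polyint1; last exact: measurable_esphere.
rewrite fine_gt0// surface_esphere_lty andbT.
rewrite -[X in (_ < X)%E]/(surface_measure R d (esphere R d)) surface_esphere.
by rewrite mule_gt0// ?lte_fin ?ltr0n// lebesgue_punctured_ball_gt0.
Qed.

Lemma omegaE : omega R d = polyint (surface_measure R d) (esphere R d) 1.
Proof. by apply: eq_Rintegral => x _; rewrite meval1. Qed.

Lemma sphere_onem_rho (h : {mpoly R[d]}) :
  polyint (surface_measure R d) (esphere R d) ((1 - rho) * h) = 0.
Proof.
transitivity (\int[surface_measure R d]_(x in esphere R d) (0 : R)); last first.
  by rewrite Rintegral_cst ?mul0r//; exact: measurable_esphere.
apply: eq_Rintegral => x; rewrite inE /esphere/= enormE => x1.
rewrite mevalM mevalB meval1 -[meval _ rho]sqr_sqrtr ?meval_rho_ge0// x1.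
by rewrite expr1n subrr mul0r.
Qed.

End total_mass.

Theorem theorem3p3 (R : realType) (d : nat) (hd : (1 <= d)%N)
    (lambda : R) (hlambda : 0 < lambda) :
  (forall (n : nat) (P : {mpoly R[d]}),
     orthopoly_m1 lambda n P ->
     Lop (-1) P = eigval d (-1) n *: P
     /\ eigval d (-1) n = - (n%:R * (n%:R + d%:R - 2)) :> R)
  /\ (exists B : set {mpoly R[d]},
        hamel_basis B /\ (forall P, B P -> eigenvector (Lop (-1)) P)).
Proof.
split; last by exists (range eigpoly); exact: eigpoly_basis.
move=> n P [Pn orth]; split; last by rewrite /eigval; ring.
have linB := polyint_linear measurable_eball lebesgue_eball_lty (@eball_box R d).
have linS := polyint_linear measurable_esphere surface_esphere_lty (@esphere_box R d).
pose B : {linear {mpoly R[d]} -> R | *%R} :=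
  HB.pack (polyint (lebesgue_tuple d) (eball R d))
    (GRing.isLinear.Build _ _ _ _ _ linB).
pose S : {linear {mpoly R[d]} -> R | *%R} :=
  HB.pack (polyint (surface_measure R d) (esphere R d))
    (GRing.isLinear.Build _ _ _ _ _ linS).
have omega_gt0 : 0 < omega R d by rewrite omegaE; exact: sphere_mass_gt0.
have innerE f g : inner_m1 lambda f g = sobolev B S (lambda / omega R d) (omega R d)^-1 f g.
  rewrite /inner_m1 /sobolev; congr (_ * _ + _ * _); apply: eq_Rintegral => x _.
    by rewrite raddf_sum; apply: eq_bigr => i _; rewrite /= mevalM.
  by rewrite mevalM.
apply: (@sobolev_orthogonal_eigen _ _ B S (lambda / omega R d) (omega R d)^-1) => //.
- exact: ball_integral_div.
- exact: polyint_sqr_ge0.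
- exact: ball_mass_gt0.
- exact: sphere_onem_rho.
- exact: sphere_drot.
- exact: polyint_sqr_ge0.
- exact: sphere_mass_gt0.
- by rewrite divr_gt0.
- by rewrite invr_gt0.
- by move=> g gn; rewrite -innerE; exact: orth.
Qed.
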